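(* Fix $\rho\in(0,1)$. Let $\boldsymbol\sigma\sim\mathbb P$, where $\mathbb P$ is the quadratic interaction model with coupling matrix $A_n$, field vector $c\in\mathbb R^n$ and base measures $\mu_1,\dots,\mu_n$; let $q\in\mathbb R^n$ with $\|q\|=1$, let $u$ be the Mean-Field optimizer, and put $T_n^*(\boldsymbol\sigma)=\sum_{i=1}^n q_i(\sigma_i-u_i)$. (i) If $\|A_n\|_4\le\rho$, then $$\mathbb E\big[(T_n^*(\boldsymbol\sigma))^2\big]\lesssim \max\big(1,\,n\alpha_n^2\big).$$ (ii) If moreover $\|A_n\|_\infty\le\rho$, then there exist positive constants $h_1,h_2$ such that for every $t>0$, $$\mathbb P\big(|T_n^*(\boldsymbol\sigma)|\ge t\big)\le h_1\exp(-h_2t^2)+h_1\exp\Big(-\frac{h_2\,t}{\sqrt n\,\alpha_n}\Big).$$ Here the implicit constant in (i) and the constants $h_1,h_2$ in (ii) depend only on $\rho$ (not on $n$, $A_n$, $c$, $\mu_i$, $q$).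
   Context: Model: $\mu_1,\dots,\mu_n$ are non-degenerate probability measures supported on $[-1,1]$, with both $-1$ and $1$ in the support of each $\mu_i$; $A_n$ is a real symmetric $n\times n$ matrix with zero diagonal; $c=(c_1,\dots,c_n)^\top\in\mathbb R^n$. The quadratic interaction model $\mathbb P$ is the probability measure on $[-1,1]^n$ with $$\frac{d\mathbb P}{d\prod_{i=1}^n\mu_i}(\boldsymbol\sigma)=\frac1{Z_n}\exp\Big(\tfrac12\boldsymbol\sigma^\top A_n\boldsymbol\sigma+c^\top\boldsymbol\sigma\Big).$$ Norms: $\|\cdot\|$ is the Euclidean norm of a vector; $\|A_n\|$ is the $\ell_2\to\ell_2$ operator norm and $\|A_n\|_r$ the $\ell_r\to\ell_r$ operator norm for $r\in(2,\infty]$. Put $\alpha_n=\max_{1\le i\le n}\sum_{j=1}^n A_n(i,j)^2$. If $\alpha_n=0$, the term $\exp(-h_2t/(\sqrt n\alpha_n))$ is read as $0$. Mean-Field optimizer: let $\psi_i(\theta)=\log\int e^{\theta z}\,d\mu_i(z)$, let $\phi_i:(-1,1)\to\mathbb R$ be the inverse of $\psi_i':\mathbb R\to(-1,1)$, and let $I_i(z)=z\phi_i(z)-\psi_i(\phi_i(z))$ (extended to $z=\pm1$ by its limits in $[0,\infty]$). Let $F(z)=\frac12z^\top A_nz+z^\top c-\sum_iI_i(z_i)$ on $[-1,1]^n$. When $\|A_n\|<1$ (in particular when $\|A_n\|_4<1$), $F$ has a unique maximizer $u\in(-1,1)^n$, and it satisfies $u_i=\psi_i'(s_i+c_i)$ with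 $s_i=\sum_jA_n(i,j)u_j$. *)

(* Defs.v *)
From HB Require Import structures.
From mathcomp Require Import all_boot all_order all_algebra.
From mathcomp Require Import all_classical all_reals all_analysis.
From mathcomp Require Import measurable_realfun.

Set Implicit Arguments.
Unset Strict Implicit.
Unset Printing Implicit Defensive.

Import Order.TTheory GRing.Theory Num.Theory.
Import numFieldNormedType.Exports.

Local Open Scope classical_set_scope.
Local Open Scope ring_scope.

Section binary_product.
Context d1 d2 (T1 : measurableType d1) (T2 : measurableType d2) (R : realType).
Variables (P1 : probability T1 R) (P2 : probability T2 R).

Definition prob_prod : set (T1 * T2) -> \bar R := (P1 \x P2)%E.

HB.instance Definition _ := Measure.copy prob_prod (P1 \x P2)%E.

Let prob_prod_setT : prob_prod setT = 1%E.
Proof.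
rewrite /prob_prod -setXTT [LHS]product_measure1E//.
by rewrite [X in (X * _)%E]probability_setT [X in (_ * X)%E]probability_setT mule1.
Qed.

HB.instance Definition _ :=
  Measure_isProbability.Build _ _ _ prob_prod prob_prod_setT.
End binary_product.

Section cons_pair.
Context d (T : measurableType d) (n : nat).

Definition cons_pair (x : T * n.-tuple T) : n.+1.-tuple T := cons_tuple x.1 x.2.

Let measurable_cons_pair : measurable_fun setT cons_pair.
Proof. exact: (@measurable_cons _ _ _ _ fst n snd). Qed.

HB.instance Definition _ :=
  isMeasurableFun.Build _ _ _ _ cons_pair measurable_cons_pair.
End cons_pair.

(* The product measure on n-tuples, characterized on boxes by prod_measureE. *)
Fixpoint prod_measure d (T : measurableType d) (R : realType) (n : nat) :
    ('I_n -> probability T R) -> probability (n.-tuple T) R :=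
  match n with
  | 0 => fun _ => \d_ [tuple]
  | m.+1 => fun mu => distribution
      (prob_prod (mu ord0) (prod_measure (fun i => mu (lift ord0 i))))
      (@cons_pair _ T m)
  end.

Lemma measurable_box d (T : measurableType d) (n : nat) (B : 'I_n -> set T) :
  (forall i, measurable (B i)) ->
  measurable [set x : n.-tuple T | forall i, B i (tnth x i)].
Proof.
move=> mB.
rewrite (_ : [set _ | _] = \bigcap_i ((@tnth n T)^~ i @^-1` B i)); last first.
  by apply/seteqP; split => x /=; [move=> xB i _|move=> xB i]; exact: xB.
apply: fin_bigcap_measurable => // i _; rewrite -[X in measurable X]setTI.
exact: measurable_tnth.
Qed.

Lemma prod_measureE d (T : measurableType d) (R : realType) (n : nat)
    (mu : 'I_n -> probability T R) (B : 'I_n -> set T) :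
  (forall i, measurable (B i)) ->
  prod_measure mu [set x | forall i, B i (tnth x i)] = (\prod_i mu i (B i))%E.
Proof.
elim: n => [|n IH] in mu B *.
  by move=> _; rewrite big_ord0 /= diracE mem_set// => -[].
move=> mB; rewrite big_ord_recl -IH//=.
rewrite /distribution /pushforward.
rewrite (_ : _ @^-1` _ = B ord0 `*`
    [set x | forall i, B (lift ord0 i) (tnth x i)]).
  rewrite [LHS]product_measure1E//; exact: (@measurable_box _ T n (fun i => B (lift ord0 i))).
apply/seteqP; split => -[a x] /=.
  by move=> aB; split => [|i]; [exact: (aB ord0)|have := aB (lift ord0 i); rewrite tnthS].
move=> [aB xB] i; case: (unliftP ord0 i) => [j ->|->//].
by rewrite tnthS.
Qed.

Section base_measure.
Context (R : realType).
Implicit Type mu : probability R R.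

Definition msupport mu : set R :=
  [set x | forall U : set R, open_nbhs x U -> (0 < mu U)%E].

(* The second clause, non-degeneracy, also follows from the last two. *)
Definition base_measure mu : Prop :=
  [/\ mu `[-1, 1]%classic = 1%E, forall a : R, (mu [set a] < 1)%E,
      msupport mu (- 1) & msupport mu 1].

(* Cumulant generating function. *)
Definition psi mu (theta : R) : R := ln (\int[mu]_z expR (theta * z)).

(* For a base_measure, psi' is a bijection from R onto ]-1, 1[; the value of
   phi outside this interval is irrelevant. *)
Definition phi mu (z : R) : R := get [set theta | derive1 (psi mu) theta = z].

Definition rate_interior mu (z : R) : R := z * phi mu z - psi mu (phi mu z).

(* The value at -1 and 1 is the one-sided limit, possibly +oo. *)
Definition rate mu (z : R) : \bar R :=
  if z == 1 then lim ((rate_interior mu x)%:E @[x --> (1 : R)^'-])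
  else if z == -1 then lim ((rate_interior mu x)%:E @[x --> (-1 : R)^'+])
  else (rate_interior mu z)%:E.
End base_measure.

Section norms.
Context (R : realType) (n : nat).

Definition lnorm (r : \bar R) (x : 'cV[R]_n) : R :=
  match r with
  | p%:E => (\sum_i `|x i 0| `^ p) `^ p^-1
  | +oo%E => \big[Num.max/0]_i `|x i 0|
  | -oo%E => 0
  end.

(* l_r -> l_r operator norm; the set is nonempty and bounded for 1 <= r <= +oo. *)
Definition opnorm (r : \bar R) (A : 'M[R]_n) : R :=
  sup [set lnorm r (A *m x) | x in [set x : 'cV[R]_n | lnorm r x <= 1]].

Definition alpha (A : 'M[R]_n) : R := \big[Num.max/0]_i \sum_j A i j ^+ 2.
End norms.

Section model.
Context (R : realType) (n : nat).
Variables (A : 'M[R]_n) (c : 'cV[R]_n) (mu : 'I_n -> probability R R).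

Definition coupling_matrix : Prop := A^T = A /\ forall i, A i i = 0.

Definition energy (x : 'cV[R]_n) : R :=
  2^-1 * (x^T *m A *m x) 0 0 + (c^T *m x) 0 0.

Definition colv (s : n.-tuple R) : 'cV[R]_n := \col_i tnth s i.

Definition tilted (U : set (n.-tuple R)) : \bar R :=
  (\int[prod_measure mu]_(s in U) (expR (energy (colv s)))%:E)%E.


Lemma energyE (x : 'cV[R]_n) : energy x =
  2^-1 * (\sum_i (\sum_j x j 0 * A j i) * x i 0) + \sum_i c i 0 * x i 0.
Proof.
rewrite /energy !mxE; congr (_ * _ + _).
  by apply: eq_bigr => i _; rewrite !mxE; congr (_ * _); apply: eq_bigr => j _; rewrite mxE.
by apply: eq_bigr => i _; rewrite mxE.
Qed.

Lemma measurable_energy : measurable_fun setT (fun s => energy (colv s)).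
Proof.
have mx i : measurable_fun setT (fun s : n.-tuple R => colv s i 0).
  rewrite (_ : (fun _ => _) = (@tnth n R)^~ i); first exact: measurable_tnth.
  by apply/funext => s; rewrite mxE.
rewrite (_ : (fun _ => _) = (fun s => 2^-1 *
    (\sum_i (\sum_j colv s j 0 * A j i) * colv s i 0) +
    \sum_i c i 0 * colv s i 0)); last by apply/funext => s; exact: energyE.
apply: measurable_funD; last first.
  by apply: measurable_sum => i; exact: measurable_funM.
apply: measurable_funM => //; apply: measurable_sum => i.
apply: measurable_funM => //; apply: measurable_sum => j.
exact: measurable_funM.
Qed.

Let measurable_weight :
  measurable_fun setT (fun s => (expR (energy (colv s)))%:E).
Proof.
by apply/measurable_EFinP; apply: measurableT_comp => //; exact: measurable_energy.
Qed.

Let tilted0 : tilted set0 = 0%E.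
Proof. exact: integral_set0. Qed.

Let tilted_ge0 U : (0 <= tilted U)%E.
Proof. by apply: integral_ge0 => s _; rewrite lee_fin expR_ge0. Qed.

Let tilted_sigma_additive : semi_sigma_additive tilted.
Proof.
move=> /= F mF tF mUF; rewrite /tilted; apply: cvg_toP.
  apply: ereal_nondecreasing_is_cvgn => k m km.
  by apply: lee_sum_nneg_natr => // i _ _; exact: tilted_ge0.
rewrite ge0_integral_bigcup//=.
by apply: measurable_funTS; exact: measurable_weight.
Qed.

HB.instance Definition _ := isMeasure.Build _ _ _ tilted
  tilted0 tilted_ge0 tilted_sigma_additive.

(* Under base_measure the total mass of tilted is positive and finite, so the
   second argument of mnormalize is never used; see quadratic_modelE. *)
Definition quadratic_model : probability (n.-tuple R) R :=
  mnormalize tilted (prod_measure mu).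

Definition partition_function : R := \int[prod_measure mu]_s expR (energy (colv s)).

Definition in_cube (x : 'cV[R]_n) : Prop := forall i, -1 <= x i 0 <= 1.

Definition mf_objective (z : 'cV[R]_n) : \bar R :=
  ((energy z)%:E - \sum_i rate (mu i) (z i ord0))%E.

Definition mf_optimizer (u : 'cV[R]_n) : Prop :=
  in_cube u /\ forall z, in_cube z -> (mf_objective z <= mf_objective u)%E.

Definition Tstar (q u : 'cV[R]_n) (s : n.-tuple R) : R :=
  \sum_i q i 0 * (tnth s i - u i 0).

Hypothesis mu_base : forall i, base_measure (mu i).

Let cube : set (n.-tuple R) := [set s | forall i, `[-1, 1]%classic (tnth s i)].

Let mcube : measurable cube.
Proof. by apply: (@measurable_box _ R n (fun=> `[-1, 1]%classic)) => i; exact: measurable_itv. Qed.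

Let cube1 : prod_measure mu cube = 1%E.
Proof.
rewrite (@prod_measureE _ _ _ _ mu (fun=> `[-1, 1]%classic))//.
by rewrite big1// => i _; have [] := mu_base i.
Qed.

Let M : R := 2^-1 * (\sum_i \sum_j `|A j i|) + \sum_i `|c i 0|.

Let energy_bound s : cube s -> `|energy (colv s)| <= M.
Proof.
move=> cs.
have c1 i : `|colv s i 0| <= 1.
  by rewrite mxE ler_norml; have := cs i; rewrite /= in_itv.
rewrite energyE (le_trans (ler_normD _ _))// lerD//.
  rewrite normrM ger0_norm ?invr_ge0// ler_wpM2l ?invr_ge0//.
  rewrite (le_trans (ler_norm_sum _ _ _))// ler_sum// => i _.
  rewrite normrM (le_trans (ler_piMr _ (c1 i)))//.
  rewrite (le_trans (ler_norm_sum _ _ _))// ler_sum// => j _.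
  by rewrite normrM ler_piMl.
rewrite (le_trans (ler_norm_sum _ _ _))// ler_sum// => i _.
by rewrite normrM ler_piMr.
Qed.

Let tilted_cube : tilted setT = tilted cube.
Proof.
rewrite -(setvU cube) measureU//; [|exact: measurableC|exact: setICl].
rewrite [X in (X + _)%E](_ : _ = 0%E) ?add0e//.
apply: null_set_integral => //=; first exact: measurableC.
  by apply: measurable_funTS; exact: measurable_weight.
by rewrite probability_setC// cube1 subee.
Qed.

Let cst_cube (r : R) : (\int[prod_measure mu]_(_ in cube) r%:E = r%:E)%E.
Proof. by rewrite integral_cst// [X in (_ * X)%E]cube1 mule1. Qed.

Let tilted_fin : (tilted setT < +oo)%E.
Proof.
rewrite tilted_cube (@le_lt_trans _ _ (expR M)%:E) ?ltry//.
rewrite -(cst_cube (expR M)); apply: ge0_le_integral => //=.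
- by apply: measurable_funTS; exact: measurable_weight.
- by move=> s cs; rewrite lee_fin ler_expR (le_trans (ler_norm _))// energy_bound.
Qed.

Let tilted_gt0 : (0 < tilted setT)%E.
Proof.
rewrite tilted_cube (@lt_le_trans _ _ (expR (- M))%:E) ?lte_fin ?expR_gt0//.
rewrite -(cst_cube (expR (- M))); apply: ge0_le_integral => //=.
- by apply: measurable_funTS; exact: measurable_weight.
- move=> s cs; rewrite lee_fin ler_expR.
  by move: (energy_bound cs); rewrite ler_norml => /andP[].
Qed.

Lemma partition_function_gt0 : 0 < partition_function.
Proof. by rewrite fine_gt0// tilted_gt0 tilted_fin. Qed.

Lemma quadratic_modelE (U : set (n.-tuple R)) : measurable U ->
  quadratic_model U = (\int[prod_measure mu]_(s in U)
    (partition_function^-1 * expR (energy (colv s)))%:E)%E.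
Proof.
move=> mU; rewrite /quadratic_model /= /mnormalize.
rewrite gt_eqF ?tilted_gt0// lt_eqF ?tilted_fin//=.
under eq_integral do rewrite EFinM.
rewrite ge0_integralZl_EFin//.
- by rewrite muleC.
- by apply: measurable_funTS; exact: measurable_weight.
- by rewrite invr_ge0 ltW// partition_function_gt0.
Qed.

End model.

(* Main.v *)
(* Write [b_i] for the mean of coordinate [i] given the others, a function of
   its local field [(A s)_i + c_i], and [g = s - b].  The Mean-Field equations
   turn [s - u = g + (b - u)] into [(1 - D A) (s - u) = g + r], where [D] is a
   diagonal contraction and [r] is quadratic in the fields [A (s - u)].  Hence
   [<q, s - u> = <q', g> + <q', r>] with [|q'| <= |q| / (1 - rho)].  As [|A|_4 < 1],
   the fields are controlled in l4 by [A g], so everything reduces to linear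
   forms [f = <q, g>].  These are sub-Gaussian: resampling coordinate [i] gives
   an exchangeable pair, and testing [f] against [f exp (eta f^2)] yields
   [E f^2 exp (eta f^2) <= C |q|^2 E (1 + 2 eta f^2) exp (eta f^2)], which bounds
   [E exp (eta f^2)] for small [eta].  The entries of [A g] are such forms, with
   [|q|^2 <= alpha A], and a Jensen argument handles their l4 norm. *)
Require Import Defs.
From HB Require Import structures.
From mathcomp Require Import all_boot all_order all_algebra.
From mathcomp Require Import all_classical all_reals all_analysis.
From mathcomp Require Import measurable_realfun ring lra.

Set Implicit Arguments.
Unset Strict Implicit.
Unset Printing Implicit Defensive.

Import Order.TTheory GRing.Theory Num.Theory.
Import numFieldNormedType.Exports.

Local Open Scope classical_set_scope.
Local Open Scope ring_scope.

(** * Bounded integrands *)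

(** Each [r_i] is at most [6 * e_i ^ 2] with [e = A (s - u)], so Cauchy-Schwarz against [q'] leaves
    the sum of the [e_i ^ 4]. This is why l4 is the natural norm, and [n * alpha ^ 2] is the size of
    a sum of [n] fourth moments of forms with squared coefficient norm at most [alpha]. Constructing
    [q'] instead needs a contraction in l2, which the symmetry of [A] extracts from the one in l4.
    The centring is at [b] rather than [u] because [g_i] has conditional mean zero given the other
    coordinates, which is what resampling exploits. Resampling one coordinate also shifts the
    conditional means of all the others; the first-order part of this response is kept as the signed
    vector [A D q], so that cancellations survive and the l2 contraction applies, and only the
    second-order part is bounded entry by entry. All estimates are made for the unnormalized weight
    against the product measure; expectations under the model are translated into such integrals at
    the end. *)

Section essentially_bounded.
Context d (T : measurableType d) (R : realType).
Variable D : set T.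
Implicit Types f g : T -> R.

(* On [D] only: the integrands are unbounded off the cube, which is null. *)
Definition ebounded f :=
  measurable_fun setT f /\ exists M, forall x, D x -> `|f x| <= M.

Lemma ebounded_cst r : ebounded (fun=> r).
Proof. by split => //; exists `|r|. Qed.

Lemma eboundedD f g : ebounded f -> ebounded g -> ebounded (fun x => f x + g x).
Proof.
move=> [mf [M fM]] [mg [N gN]]; split; first exact: measurable_funD.
exists (M + N) => x Dx; rewrite (le_trans (ler_normD _ _))// lerD//.
  exact: fM.
exact: gN.
Qed.

Lemma eboundedM f g : ebounded f -> ebounded g -> ebounded (fun x => f x * g x).
Proof.
move=> [mf [M fM]] [mg [N gN]]; split; first exact: measurable_funM.
by exists (M * N) => x Dx; rewrite normrM ler_pM ?fM ?gN.
Qed.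

Lemma eboundedN f : ebounded f -> ebounded (fun x => - f x).
Proof.
move=> [mf [M fM]]; split; first exact: measurableT_comp.
by exists M => x Dx; rewrite normrN fM.
Qed.

Lemma eboundedB f g : ebounded f -> ebounded g -> ebounded (fun x => f x - g x).
Proof. by move=> ef eg; apply: eboundedD => //; exact: eboundedN. Qed.

Lemma ebounded_norm f : ebounded f -> ebounded (fun x => `|f x|).
Proof.
move=> [mf [M fM]]; split; first exact: measurableT_comp.
by exists M => x Dx; rewrite normr_id fM.
Qed.

Lemma eboundedX f k : ebounded f -> ebounded (fun x => f x ^+ k).
Proof.
move=> [mf [M fM]]; split; first exact: measurable_funX.
by exists (M ^+ k) => x Dx; rewrite normrX lerXn2r ?nnegrE ?fM// (le_trans _ (fM _ Dx)).
Qed.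

Lemma ebounded_expR f : ebounded f -> ebounded (fun x => expR (f x)).
Proof.
move=> [mf [M fM]]; split; first exact: measurableT_comp.
exists (expR M) => x Dx; rewrite ger0_norm ?expR_ge0// ler_expR.
by rewrite (le_trans (ler_norm _)) ?fM.
Qed.

Lemma ebounded_sum (I : Type) (r : seq I) (F : I -> T -> R) :
  (forall i, ebounded (F i)) -> ebounded (fun x => \sum_(i <- r) F i x).
Proof.
move=> eF; elim: r => [|i r IH].
  by under eq_fun do rewrite big_nil; exact: ebounded_cst.
by under eq_fun do rewrite big_cons; exact: eboundedD.
Qed.

Variable P : probability T R.
Hypotheses (mD : measurable D) (PD : P D = 1%E).

Lemma P_setC_ebounded : P (~` D) = 0%E.
Proof. by rewrite probability_setC// PD subee. Qed.

Lemma ebounded_integrable f : ebounded f -> P.-integrable setT (EFin \o f).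
Proof.
move=> [mf [M fM]]; apply/integrableP; split; first exact/measurable_EFinP.
apply: (@le_lt_trans _ _ (\int[P]_x (`|M|)%:E)%E).
  apply: ae_ge0_le_integral => //.
  - by apply: measurableT_comp => //; exact/measurable_EFinP.
  exists (~` D); split; [exact: measurableC|exact: P_setC_ebounded|].
  move=> x /=; apply: contra_not => Dx _; rewrite lee_fin.
  by rewrite (le_trans (fM _ Dx))// ler_norm.
by rewrite integral_cst// [X in (_ * X)%E]probability_setT mule1 ltry.
Qed.

Lemma le_ebounded_Rintegral f g : ebounded f -> ebounded g ->
  (forall x, D x -> f x <= g x) -> \int[P]_x f x <= \int[P]_x g x.
Proof.
move=> ef eg fg.
have -> : \int[P]_x f x = \int[P]_(x in D) f x.
  rewrite /Rintegral (negligible_integral (measurableC mD))//.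
  - by rewrite setDE setTI setCK.
  - exact: ebounded_integrable.
  - exact: P_setC_ebounded.
have -> : \int[P]_x g x = \int[P]_(x in D) g x.
  rewrite /Rintegral (negligible_integral (measurableC mD))//.
  - by rewrite setDE setTI setCK.
  - exact: ebounded_integrable.
  - exact: P_setC_ebounded.
by apply: le_Rintegral => //; apply: integrableS (ebounded_integrable _).
Qed.

Lemma Rintegral_cst1 r : \int[P]_x r = r.
Proof. by rewrite Rintegral_cst// [X in fine X]probability_setT mulr1. Qed.

Lemma ebounded_RintegralD f g : ebounded f -> ebounded g ->
  \int[P]_x (f x + g x) = \int[P]_x f x + \int[P]_x g x.
Proof. by move=> ef eg; rewrite RintegralD//; exact: ebounded_integrable. Qed.

Lemma ebounded_RintegralB f g : ebounded f -> ebounded g ->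
  \int[P]_x (f x - g x) = \int[P]_x f x - \int[P]_x g x.
Proof. by move=> ef eg; rewrite RintegralB//; exact: ebounded_integrable. Qed.

Lemma ebounded_RintegralZ r f : ebounded f ->
  \int[P]_x (r * f x) = r * \int[P]_x f x.
Proof. by move=> ef; rewrite RintegralZl//; exact: ebounded_integrable. Qed.

Lemma ebounded_Rintegral_sum (I : Type) (r : seq I) (F : I -> T -> R) :
  (forall i, ebounded (F i)) ->
  \int[P]_x (\sum_(i <- r) F i x) = \sum_(i <- r) \int[P]_x F i x.
Proof.
move=> eF; elim: r => [|i r IH].
  by under eq_Rintegral do rewrite big_nil; rewrite Rintegral_cst1 big_nil.
under eq_Rintegral do rewrite big_cons.
rewrite ebounded_RintegralD// ?IH ?big_cons//; exact: ebounded_sum.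
Qed.

Lemma normr_ebounded_Rintegral f M : ebounded f ->
  (forall x, D x -> `|f x| <= M) -> `|\int[P]_x f x| <= M.
Proof.
move=> ef fM; rewrite ler_norml -[X in X <= _ <= _]Rintegral_cst1.
rewrite -[X in _ <= _ <= X]Rintegral_cst1.
by rewrite !le_ebounded_Rintegral//; try (by move=> x /fM; rewrite ler_norml => /andP[]);
  exact: ebounded_cst.
Qed.

End essentially_bounded.

(** * Cumulant generating functions and their conjugates *)

Lemma expR_quadratic_bound (R : realType) (x : R) : `|x| <= 2^-1 ->
  `|expR x - 1 - x| <= 2 * x ^+ 2.
Proof.
rewrite ler_norml => /andP[x1 x2].
have e1 := expR_ge1Dx x; have e2 := expR_ge1Dx (- x).
have : expR x * expR (- x) = 1 by rewrite -expRD subrr expR0.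
have := expR_gt0 x; set a := expR x in e1 *; set b := expR (- x) in e2 *.
move=> a0 ab.
have h : a * (1 - x) <= 1 by rewrite -[leRHS]ab ler_wpM2l// ltW.
rewrite ger0_norm; last by lra.
(* The right-hand side is [1 + x ^+ 2 * (1 - 2 * x)], which is at least 1 because [x <= 2^-1]. *)
have : a * (1 - x) <= (1 + x + 2 * x ^+ 2) * (1 - x) by nra.
rewrite ler_pM2r; last lra.
by move=> ?; lra.
Qed.

(** Serves to differentiate under the integral sign: a pointwise second-order bound on the
    integrand, uniform on the cube, integrates to a bound of this shape. *)
Lemma is_derive_quadratic (R : realType) (f : R -> R) (t d C : R) :
  (forall h, `|h| <= 2^-1 -> `|f (t + h) - f t - h * d| <= C * h ^+ 2) ->
  is_derive t 1 f d.
Proof.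
move=> fh.
suff H : h^-1 *: (f (h *: 1 + t) - f t) @[h --> 0^'] --> d.
  by apply: DeriveDef; [apply: cvgP H|rewrite /derive; exact: cvg_lim H].
apply/cvgrPdist_le => /= e e0.
have C0 : 0 < `|C| + 1 by rewrite ltr_pwDr.
near=> h.
have h0 : h != 0 by near: h; exact: nbhs_dnbhs_neq.
have h1 : `|h| <= 2^-1.
  near: h; apply: dnbhs0_le; lra.
have h2 : `|h| <= e / (`|C| + 1) by near: h; apply: dnbhs0_le; rewrite divr_gt0.
rewrite /GRing.scale/= mulr1 (addrC h) distrC.
rewrite (_ : _ - d = h^-1 * (f (t + h) - f t - h * d)); last by field.
rewrite normrM normfV ler_pdivrMl ?normr_gt0//.
rewrite (le_trans (fh _ h1))// -real_normK ?num_real// expr2 mulrCA ler_wpM2l//.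
rewrite (@le_trans _ _ ((`|C| + 1) * `|h|))//; last by rewrite mulrC -ler_pdivlMr.
by rewrite ler_wpM2r// (le_trans (ler_norm _))// lerDl.
Unshelve. all: by end_near. Qed.

Section base_measure_theory.
Context (R : realType) (mu : probability R R).
Hypothesis hmu : base_measure mu.

Let D : set R := `[-1, 1]%classic.

Let mD : measurable D. Proof. exact: measurable_itv. Qed.

Let muD : mu D = 1%E. Proof. by have [] := hmu. Qed.

Let De x : D x -> `|x| <= 1. Proof. by rewrite /D /= in_itv ler_norml. Qed.

(** The [k]-th derivative at [t] of the moment generating function of [mu]. *)
Definition mexp (k : nat) (t : R) := \int[mu]_z (z ^+ k * expR (t * z)).

Let eb_id : ebounded D (@id R).
Proof. by split; [exact: measurable_id|exists 1; exact: De]. Qed.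

Lemma ebounded_pow_exp k t : ebounded D (fun z : R => z ^+ k * expR (t * z)).
Proof.
apply: eboundedM; first exact: eboundedX.
by apply: ebounded_expR; apply: eboundedM => //; exact: ebounded_cst.
Qed.

Lemma mexp0_gt0 t : 0 < mexp 0 t.
Proof.
apply: (@lt_le_trans _ _ (expR (- `|t|))); first exact: expR_gt0.
rewrite -(Rintegral_cst1 mu (expR (- `|t|))) /mexp.
apply: (le_ebounded_Rintegral mD muD); [exact: ebounded_cst|exact: ebounded_pow_exp|].
move=> x /De x1; rewrite expr0 mul1r ler_expR.
suff : `|t * x| <= `|t| by rewrite ler_norml => /andP[].
by rewrite normrM ler_piMr.
Qed.

Lemma mexp_le k t : `|mexp k t| <= mexp 0 t.
Proof.
rewrite ler_norml -[X in X <= _ <= _]mulN1r.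
rewrite -(ebounded_RintegralZ mD muD (-1) (ebounded_pow_exp 0 t)).
apply/andP; split; apply: (le_ebounded_Rintegral mD muD);
  try exact: ebounded_pow_exp.
- by apply: eboundedM; [exact: ebounded_cst|exact: ebounded_pow_exp].
- move=> x /De x1; rewrite expr0 mulrA mulr1 ler_wpM2r ?expR_ge0//.
  by rewrite lerNl (le_trans (ler_norm _))// normrN normrX exprn_ile1.
- move=> x /De x1; rewrite expr0 ler_wpM2r ?expR_ge0//.
  by rewrite (le_trans (ler_norm _))// normrX exprn_ile1.
Qed.

Lemma is_derive_mexp k (t : R) : is_derive t 1 (mexp k) (mexp k.+1 t).
Proof.
apply: (@is_derive_quadratic _ _ _ _ (2 * expR `|t|)) => h h2.
have eb1 := ebounded_pow_exp.
have eb2 r g : ebounded D g -> ebounded D (fun z : R => r * g z).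
  by move=> eg; apply: eboundedM => //; exact: ebounded_cst.
rewrite /mexp -(ebounded_RintegralB mD muD)// -(ebounded_RintegralZ mD muD)//.
have eb3 := eboundedB (eb1 k (t + h)) (eb1 k t).
rewrite -(ebounded_RintegralB mD muD)//; last exact: eb2.
apply: (normr_ebounded_Rintegral mD muD).
  by apply: eboundedB => //; exact: eb2.
move=> x /De x1.
rewrite mulrDl expRD exprS.
rewrite (_ : _ - _ = x ^+ k * expR (t * x) * (expR (h * x) - 1 - h * x)); last by ring.
rewrite normrM (mulrC 2) -mulrA ler_pM//.
  rewrite normrM (ger0_norm (expR_ge0 _)) -[leRHS]mul1r ler_pM ?expR_ge0//.
    by rewrite normrX exprn_ile1.
  by rewrite ler_expR (le_trans (ler_norm _))// normrM ler_piMr.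
have hx : `|h * x| <= 2^-1 by rewrite normrM (le_trans _ h2)// ler_piMr.
rewrite (le_trans (expR_quadratic_bound hx))// ler_wpM2l// exprMn ler_piMr ?sqr_ge0//.
by rewrite -real_normK ?num_real// exprn_ile1.
Qed.

(** With [tilt_var], the first two derivatives of [psi mu]: mean and variance of the law whose
    density with respect to [mu] is proportional to [expR (t * z)]. *)
Definition tilt_mean t := mexp 1 t / mexp 0 t.

Definition tilt_var t := mexp 2 t / mexp 0 t - tilt_mean t ^+ 2.

Lemma psiE t : psi mu t = ln (mexp 0 t).
Proof.
rewrite /psi /mexp; congr (ln _); apply: eq_Rintegral => z _.
by rewrite expr0 mul1r.
Qed.

Lemma is_derive_psi (t : R) : is_derive t 1 (psi mu) (tilt_mean t).
Proof.
rewrite (_ : psi mu = @ln R \o mexp 0); last by apply/funext => x; rewrite psiE.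
have h1 := is_derive_mexp 0 t.
have h2 := is_derive1_ln (mexp0_gt0 t).
by rewrite /tilt_mean mulrC; apply: is_derive1_comp.
Qed.

Lemma derive1_psi t : derive1 (psi mu) t = tilt_mean t.
Proof. by rewrite derive1E; have /@derive_val := is_derive_psi t. Qed.

Lemma is_derive_ratio k (t : R) : is_derive t 1 (fun t => mexp k t / mexp 0 t)
  (mexp k.+1 t / mexp 0 t - mexp k t / mexp 0 t * tilt_mean t).
Proof.
have m0 : mexp 0 t != 0 by rewrite gt_eqF// mexp0_gt0.
have h0 := is_derive_mexp 0 t; have hk := is_derive_mexp k t.
have h1 := @is_deriveV _ (mexp 0) _ _ _ m0 h0.
apply: (is_derive_eq (is_deriveM hk h1)).
by rewrite /GRing.scale/= /tilt_mean; field.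
Qed.

Lemma is_derive_tilt_mean (t : R) : is_derive t 1 tilt_mean (tilt_var t).
Proof. by apply: is_derive_eq; [exact: is_derive_ratio|rewrite /tilt_var expr2]. Qed.

Lemma ratio_le k t : `|mexp k t / mexp 0 t| <= 1.
Proof.
rewrite normrM normfV (ger0_norm (ltW (mexp0_gt0 t))).
by rewrite ler_pdivrMr ?mexp0_gt0// mul1r mexp_le.
Qed.

Lemma tilt_mean_le1 t : `|tilt_mean t| <= 1. Proof. exact: ratio_le. Qed.

Lemma is_derive_tilt_var (t : R) : exists2 d, `|d| <= 6 & is_derive t 1 tilt_var d.
Proof.
(* The third cumulant. Normalized moments are at most 1 in absolute value and the variance is
   crudely at most 2, whence 6 = 1 + 1 + 2 * 2. *)
exists (mexp 3 t / mexp 0 t - mexp 2 t / mexp 0 t * tilt_mean t -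
  2 * tilt_mean t * tilt_var t).
  rewrite /tilt_var; have := ratio_le 3 t; have := ratio_le 2 t; have := tilt_mean_le1 t.
  set a := _ 3%N _ / _; set b := _ 2%N _ / _; set m := tilt_mean t.
  move=> m1 b1 a1.
  have bm : `|b * m| <= 1 by rewrite normrM mulr_ile1.
  have m2 : `|m ^+ 2| <= 1 by rewrite normrX exprn_ile1.
  have : `|m * (b - m ^+ 2)| <= 2.
    rewrite normrM -[leRHS]mul1r ler_pM// (le_trans (ler_normB _ _))//; lra.
  rewrite -mulrA; set x := m * (b - _); set y := b * m in bm *.
  move: a1 bm; rewrite !ler_norml; lra.
have h1 := is_derive_ratio 2 t; have h2 := is_derive_tilt_mean t.
have h3 := @is_deriveX _ _ tilt_mean 2 t 1 _ h2.
rewrite (_ : tilt_var = (fun t => mexp 2 t / mexp 0 t) - tilt_mean ^+ 2)//.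
by apply: (is_derive_eq (is_deriveB h1 h3)); rewrite /GRing.scale/= expr1.
Qed.

Let is_derive_continuous (f df : R -> R) :
  (forall x : R, is_derive x 1 f (df x)) -> continuous f.
Proof.
move=> H x; apply: differentiable_continuous; apply/derivable1_diffP.
by have [] := H x.
Qed.

Lemma continuous_mexp k : continuous (mexp k).
Proof. exact: is_derive_continuous (is_derive_mexp k). Qed.

Lemma continuous_tilt_mean : continuous tilt_mean.
Proof. exact: is_derive_continuous is_derive_tilt_mean. Qed.

Lemma continuous_tilt_var : continuous tilt_var.
Proof.
move=> x; apply: differentiable_continuous; apply/derivable1_diffP.
by have [d _ []] := is_derive_tilt_var x.
Qed.

End base_measure_theory.
(** That [c] lies between [x] and [y] is expressed without ordering them: the distance bound serves
    second-order errors, the sign condition serves convexity. *)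
Lemma MVT_dist (R : realType) (f df : R -> R) (x y : R) :
  (forall z : R, is_derive z 1 f (df z)) ->
  exists c, [/\ `|c - y| <= `|x - y|, 0 <= (c - y) * (x - y) &
    f x - f y = df c * (x - y)].
Proof.
move=> fdf.
have cf : continuous f.
  move=> z; apply: differentiable_continuous; apply/derivable1_diffP.
  by have [] := fdf z.
have [xy|yx] := leP y x.
  have [c + ->] := MVT_segment xy (fun z _ => fdf z) (continuous_subspaceT cf).
  rewrite in_itv/= => /andP[yc cx]; exists c; split => //.
    by rewrite !ger0_norm ?subr_ge0// lerD2r.
  by rewrite mulr_ge0 ?subr_ge0.
have [c + e] := MVT_segment (ltW yx) (fun z _ => fdf z) (continuous_subspaceT cf).
rewrite in_itv/= => /andP[xc cy]; exists c; split => //.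
- by rewrite !ler0_norm ?subr_le0 ?(ltW yx)// lerN2 lerD2r.
- by rewrite mulr_le0 ?subr_le0 ?(ltW yx).
- by rewrite -opprB e -mulrN opprB.
Qed.

(** Markov's inequality, with its conditions tested on [D] only. *)
Lemma Rintegral_ge_indic d (T : measurableType d) (R : realType)
    (P : probability T R) (D U : set T) (f : T -> R) (c : R) :
  measurable D -> P D = 1%E -> measurable U -> ebounded D f ->
  (forall x, D x -> 0 <= f x) -> (forall x, D x -> U x -> c <= f x) ->
  c * fine (P U) <= \int[P]_x f x.
Proof.
move=> mD PD mU ef f0 fc.
have eU : ebounded D (\1_U : T -> R).
  split => //; exists 1 => x _.
  by rewrite indicE; case: (_ \in _); rewrite ?normr0 ?normr1.
rewrite (_ : fine (P U) = \int[P]_x \1_U x); last first.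
  by rewrite /Rintegral integral_indic// setIT.
rewrite -(ebounded_RintegralZ mD PD c eU).
apply: (le_ebounded_Rintegral mD PD) => //.
  by apply: eboundedM => //; exact: ebounded_cst.
move=> x Dx; rewrite indicE; case: (boolP (x \in U)) => [|_].
  by rewrite inE mulr1 => /fc; exact.
by rewrite mulr0 f0.
Qed.

(** * Tilted means and Fenchel duality inside the interval *)

Section base_measure_duality.
Context (R : realType) (mu : probability R R).
Hypothesis hmu : base_measure mu.

Let D : set R := `[-1, 1]%classic.

Let mD : measurable D. Proof. exact: measurable_itv. Qed.

Let muD : mu D = 1%E. Proof. by have [] := hmu. Qed.

Let De x : D x -> `|x| <= 1. Proof. by rewrite /D /= in_itv ler_norml. Qed.

Local Notation p := (tilt_mean mu).
Local Notation v := (tilt_var mu).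
Local Notation psi := (psi mu).

Let eb := @ebounded_pow_exp R.

Lemma tilt_var_bound t : 0 <= v t <= 1.
Proof.
apply/andP; split; last first.
  have := ratio_le hmu 2 t; rewrite /tilt_var ler_norml => /andP[_].
  have := sqr_ge0 (p t); lra.
have m0 := mexp0_gt0 hmu t.
have cst r : ebounded D (fun=> r : R) by exact: ebounded_cst.
have Z k r : ebounded D (fun z : R => r * (z ^+ k * expR (t * z))) by exact: eboundedM.
(* The integrand is [(z - p t) ^+ 2 * expR (t * z)], expanded so that its integral is read off from
   the moments. *)
have : 0 <= \int[mu]_z ((z ^+ 2 * expR (t * z) -
    (2 * p t) * (z ^+ 1 * expR (t * z))) + p t ^+ 2 * (z ^+ 0 * expR (t * z))).
  rewrite -(Rintegral_cst1 mu 0); apply: (le_ebounded_Rintegral mD muD) => //.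
    by apply: eboundedD => //; apply: eboundedB.
  move=> x _; rewrite [leRHS](_ : _ = (x - p t) ^+ 2 * expR (t * x)); last by ring.
  by rewrite mulr_ge0 ?sqr_ge0 ?expR_ge0.
rewrite (ebounded_RintegralD mD muD (eboundedB (eb 2 t) (Z 1 _)) (Z 0 _)).
rewrite (ebounded_RintegralB mD muD (eb 2 t) (Z 1 _)).
rewrite !(ebounded_RintegralZ mD muD _ (eb _ t)).
rewrite -/(mexp mu 2 t) -/(mexp mu 1 t) -/(mexp mu 0 t).
rewrite (_ : _ + _ = v t * mexp mu 0 t) ?pmulr_lge0//.
by rewrite /tilt_var /tilt_mean; field; rewrite gt_eqF.
Qed.

Lemma tilt_mean_lipschitz x y : `|p x - p y| <= `|x - y|.
Proof.
have [c [_ _ ->]] := MVT_dist x y (is_derive_tilt_mean hmu).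
by rewrite normrM ler_piMl// ger0_norm; have /andP[] := tilt_var_bound c.
Qed.

(** The mean value theorem is applied to [p] and then to [v], whose derivative is at most 6 in
    absolute value. *)
Lemma tilt_mean_quadratic x y : `|p x - p y - v y * (x - y)| <= 6 * (x - y) ^+ 2.
Proof.
have [c [cy _ ->]] := MVT_dist x y (is_derive_tilt_mean hmu).
have dv z : is_derive (z : R) 1 v (derive1 v z).
  by rewrite derive1E; apply: derivableP; have [d _ []] := is_derive_tilt_var hmu z.
have dv6 z : `|derive1 v z| <= 6.
  by have [d d6 [_ dz]] := is_derive_tilt_var hmu z; rewrite derive1E dz.
have [e [_ _ E]] := MVT_dist c y dv.
rewrite -mulrBl E -mulrA normrM ler_pM// normrM -real_normK ?num_real// expr2.
by rewrite ler_wpM2r.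
Qed.

Lemma tilt_mean_homo x y : x <= y -> p x <= p y.
Proof.
move=> xy; have [c [_ _ E]] := MVT_dist y x (is_derive_tilt_mean hmu).
rewrite -subr_ge0 E; apply: mulr_ge0; last by rewrite subr_ge0.
by have /andP[] := tilt_var_bound c.
Qed.

Lemma psi_tangent s t : psi s + p s * (t - s) <= psi t.
Proof.
have [c [_ cs E]] := MVT_dist t s (is_derive_psi hmu).
have [d [_ _ F]] := MVT_dist c s (is_derive_tilt_mean hmu).
rewrite -subr_ge0 opprD addrA E -mulrBl F -mulrA mulr_ge0//.
by have /andP[] := tilt_var_bound d.
Qed.

Lemma psi0 : psi 0 = 0.
Proof.
rewrite psiE /mexp; under eq_Rintegral do rewrite mul0r expR0 expr0 mulr1.
by rewrite Rintegral_cst1 ln1.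
Qed.

Let mass_gt0 e U : msupport mu e -> open_nbhs e U -> 0 < fine (mu U).
Proof.
move=> + eU => /(_ _ eU) U0; rewrite fine_gt0// U0/=.
apply: le_lt_trans (ltry 1); apply: probability_le1.
by case: eU => oU _; exact: open_measurable.
Qed.

(** The sign [e] treats both endpoints at once. The half-line where [e * y < 0] is a neighbourhood
    of [- e], so it has positive mass, and there [1 - e * y > 1]; hence the tilted mean of
    [1 - e * y] is positive. *)
Let tilt_mean_lt e t : e ^+ 2 = 1 -> msupport mu (- e) -> e * p t < 1.
Proof.
move=> e1 supp.
have cst r : ebounded D (fun=> r : R) by exact: ebounded_cst.
have oU : open_nbhs (- e) [set y | e * y < 0].
  split; last by rewrite /= mulrN -expr2 e1 ltrN10.
  rewrite (_ : [set _ | _] = (fun y => e * y) @^-1` [set z | z < 0])//.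
  apply: open_comp; last exact: open_lt.
  by move=> x _; apply: cvgMr; exact: cvg_id.
have m0 := mexp0_gt0 hmu t.
have : expR (- `|t|) * fine (mu [set y | e * y < 0]) <=
    \int[mu]_z (z ^+ 0 * expR (t * z) - e * (z ^+ 1 * expR (t * z))).
  have en : `|e| = 1 by apply/eqP; rewrite -(@pexpr_eq1 _ _ 2) ?normr_ge0// -normrX e1 normr1.
  apply: (Rintegral_ge_indic mD muD).
  - by case: oU => oU _; exact: open_measurable.
  - by apply: eboundedB => //; exact: eboundedM.
  - move=> x /De x1; rewrite (_ : _ - _ = (1 - e * x) * expR (t * x)); last by ring.
    rewrite mulr_ge0 ?expR_ge0// subr_ge0 (le_trans (ler_norm _))//.
    by rewrite normrM en mul1r.
  - move=> x /De x1 /= ex.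
    rewrite (_ : _ - _ = (1 - e * x) * expR (t * x)); last by ring.
    rewrite -[leLHS]mul1r ler_pM ?expR_ge0//; first lra.
    rewrite ler_expR.
    suff : `|t * x| <= `|t| by rewrite ler_norml => /andP[].
    by rewrite normrM ler_piMr.
rewrite (ebounded_RintegralB mD muD (eb 0 t) (eboundedM (cst e) (eb 1 t))).
rewrite (ebounded_RintegralZ mD muD _ (eb 1 t)) -/(mexp mu 1 t) -/(mexp mu 0 t) => h.
rewrite /tilt_mean mulrA ltr_pdivrMr// mul1r -subr_gt0.
by rewrite (lt_le_trans _ h)// mulr_gt0 ?expR_gt0// (mass_gt0 supp).
Qed.

Lemma tilt_mean_lt1 t : `|p t| < 1.
Proof.
have [_ _ sN s1] := hmu; rewrite ltr_norml; apply/andP; split.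
  rewrite ltrNl -mulN1r; apply: tilt_mean_lt; last by rewrite opprK.
  by rewrite sqrrN expr1n.
by rewrite -[ltLHS]mul1r; apply: tilt_mean_lt; rewrite ?expr1n.
Qed.

(* [psi t / t] is at most [p t] by convexity and at least [b + C / t] because
   the endpoint [e] is in the support. *)
Let tilt_mean_unbounded e a : e ^+ 2 = 1 -> msupport mu e -> a < 1 ->
  exists t, a <= e * p t.
Proof.
move=> e1 supp a1; pose b := (1 + a) / 2.
have b1 : b < 1 by rewrite /b; lra.
have ab : a < b by rewrite /b; lra.
have oU : open_nbhs e [set y | b < e * y].
  split; last by rewrite /= -expr2 e1.
  rewrite (_ : [set _ | _] = (fun y => e * y) @^-1` [set z | b < z])//.
  apply: open_comp; last exact: open_gt.
  by move=> x _; apply: cvgMr; exact: cvg_id.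
have U0 := mass_gt0 supp oU; set m := fine _ in U0.
have m1 : m <= 1.
  rewrite -[1]/(fine 1%E) /m fine_le//.
    by rewrite fin_num_measure//; case: oU => oU _; exact: open_measurable.
  by apply: probability_le1; case: oU => oU _; exact: open_measurable.
have low s : 0 < s -> s * b + ln m <= psi (e * s).
  move=> s0; rewrite psiE -[s * b]expRK -lnM ?posrE ?expR_gt0//.
  rewrite ler_ln ?posrE ?mulr_gt0 ?expR_gt0 ?mexp0_gt0//.
  apply: (Rintegral_ge_indic mD muD).
  - by case: oU => oU _; exact: open_measurable.
  - exact: eb.
  - by move=> x _; rewrite expr0 mul1r expR_ge0.
  - move=> x _ /= bx; rewrite expr0 mul1r ler_expR (mulrC e) -mulrA.
    by apply: ler_wpM2l; exact: ltW.
pose C := - ln m; have C0 : 0 <= C by rewrite oppr_ge0 ln_le0.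
(* Large enough for the gain [s * (b - a)] to absorb the cost [C] of restricting to the
   neighbourhood of [e]; the added 1 makes [s] positive. *)
pose s := C / (b - a) + 1.
have s0 : 0 < s by rewrite ltr_pwDr// divr_ge0// subr_ge0 ltW.
exists (e * s).
have := psi_tangent (e * s) 0; rewrite psi0 sub0r mulrN subr_le0 => tan.
have : s * b - C <= (e * p (e * s)) * s.
  by rewrite opprK (le_trans (low _ s0))// (le_trans tan)// mulrCA mulrA.
suff : s * a <= s * b - C.
  move=> h1 h2; have := le_trans h1 h2.
  by rewrite mulrC ler_pM2r.
suff : C <= s * (b - a) by lra.
by rewrite /s mulrDl mul1r divfK ?gt_eqF ?subr_gt0// lerDl subr_ge0 ltW.
Qed.

Lemma tilt_mean_surj x : -1 < x < 1 -> exists t, p t = x.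
Proof.
move=> /andP[xN x1]; have [_ _ sN s1] := hmu.
have [t1] := tilt_mean_unbounded (expr1n _ 2) s1 x1.
have [t2] : exists t, - x <= -1 * p t.
  by apply: tilt_mean_unbounded => //; [rewrite sqrrN expr1n|rewrite ltrNl].
rewrite mulN1r mul1r lerN2 => h2 h1.
(* At this point [p t2 <= x <= p t1]. If [t1 <= t2], monotonicity forces equality; otherwise the
   intermediate value theorem applies. *)
have [t12|/ltW t21] := leP t1 t2.
  by exists t1; apply/eqP; rewrite eq_le h1 (le_trans (tilt_mean_homo t12)).
have [|t _ <-] := IVT t21 (continuous_subspaceT (continuous_tilt_mean hmu)) (_ : Num.min (p t2) (p t1) <= x <= Num.max (p t2) (p t1)).
  by rewrite (min_idPl (tilt_mean_homo t21)) (max_idPr (tilt_mean_homo t21)) h2.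
by exists t.
Qed.

Lemma tilt_mean_phi x : -1 < x < 1 -> p (phi mu x) = x.
Proof.
move=> /tilt_mean_surj[t tx]; rewrite -derive1_psi//.
by apply: (@getPex _ [set t | derive1 psi t = x]); exists t; rewrite /= derive1_psi.
Qed.

Lemma fenchel x t : -1 < x < 1 -> x * t - psi t <= rate_interior mu x.
Proof.
move=> /tilt_mean_phi xphi; have := psi_tangent (phi mu x) t.
by rewrite xphi /rate_interior; lra.
Qed.

(** One inequality is [fenchel], the other is the tangent of [psi] at [t] evaluated at
    [phi mu (p t)]. *)
Lemma rate_interior_tilt_mean t : rate_interior mu (p t) = p t * t - psi t.
Proof.
have pt : -1 < p t < 1 by rewrite -ltr_norml tilt_mean_lt1.
apply/eqP; rewrite eq_le fenchel// andbT /rate_interior.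
by have := psi_tangent t (phi mu (p t)); lra.
Qed.

Lemma rate_interior_ge0 x : -1 < x < 1 -> 0 <= rate_interior mu x.
Proof. by move=> /(fenchel 0); rewrite mulr0 psi0 subr0. Qed.

(** To the right of [p 0] the slope [phi mu x] of the conjugate is nonnegative. This monotonicity,
    with its mirror image on the left, makes the one-sided limits in [rate] exist. *)
Lemma rate_interior_le_right x y : p 0 < x -> x <= y -> y < 1 ->
  rate_interior mu x <= rate_interior mu y.
Proof.
move=> px xy y1; have /andP[p1 _] : -1 < p 0 < 1 by rewrite -ltr_norml tilt_mean_lt1.
have xI : -1 < x < 1 by rewrite (lt_trans p1 px) (le_lt_trans xy).
have yI : -1 < y < 1 by rewrite y1 (lt_le_trans _ xy) ?(lt_trans p1 px).
have phi0 : 0 <= phi mu x.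
  by rewrite leNgt; apply/negP => /ltW/tilt_mean_homo; rewrite tilt_mean_phi// leNgt px.
apply: le_trans (fenchel (phi mu x) yI).
by rewrite /rate_interior lerD2r ler_wpM2r.
Qed.

Lemma rate_interior_le_left x y : x < p 0 -> y <= x -> -1 < y ->
  rate_interior mu x <= rate_interior mu y.
Proof.
move=> px xy y1; have /andP[_ p1] : -1 < p 0 < 1 by rewrite -ltr_norml tilt_mean_lt1.
have xI : -1 < x < 1 by rewrite (lt_trans px p1) (lt_le_trans y1).
have yI : -1 < y < 1 by rewrite y1 (le_lt_trans xy) ?(lt_trans px p1).
have phi0 : phi mu x <= 0.
  by rewrite leNgt; apply/negP => /ltW/tilt_mean_homo; rewrite tilt_mean_phi// leNgt px.
apply: le_trans (fenchel (phi mu x) yI).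
by rewrite /rate_interior lerD2r ler_wnM2r.
Qed.

End base_measure_duality.

(** * The rate function on the closed interval *)

Section rate_theory.
Context (R : realType) (mu : probability R R).
Hypothesis hmu : base_measure mu.

Local Notation p := (tilt_mean mu).
Local Notation psi := (psi mu).

Lemma rate_interior_cvg1 :
  cvg ((rate_interior mu x)%:E @[x --> (1 : R)^'-]).
Proof.
have p1 : p 0 < 1.
  by have := tilt_mean_lt1 hmu 0; rewrite ltr_norml => /andP[].
(* Reflection turns the left limit at 1 into a right limit of a nonincreasing function. *)
suff /cvg_ex[l H] : cvg ((fun x => (rate_interior mu x)%:E) \o -%R @ (- (1 : R))^'+).
  by apply/cvg_ex; exists l; apply/cvg_at_leftNP.
apply: nonincreasing_at_right_is_cvge; near=> e => x y.
have ep : e < - p 0.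
  by near: e; apply: nbhs_right_lt; rewrite ltrN2.
rewrite !in_itv/= => /andP[x1 xe] /andP[y1 ye] xy; rewrite lee_fin.
apply: rate_interior_le_right => //.
- by rewrite ltrNr (lt_trans ye).
- by rewrite lerN2.
- by rewrite ltrNl.
Unshelve. all: by end_near. Qed.

Lemma rate_interior_cvgN1 :
  cvg ((rate_interior mu x)%:E @[x --> (-1 : R)^'+]).
Proof.
have p1 : - 1 < p 0.
  by have := tilt_mean_lt1 hmu 0; rewrite ltr_norml => /andP[].
apply: nonincreasing_at_right_is_cvge; near=> e => x y.
have ep : e < p 0 by near: e; exact: nbhs_right_lt.
rewrite !in_itv/= => /andP[x1 xe] /andP[y1 ye] xy; rewrite lee_fin.
by apply: rate_interior_le_left => //; exact: lt_trans ye ep.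
Unshelve. all: by end_near. Qed.

Lemma rate_interiorE x : -1 < x < 1 -> rate mu x = (rate_interior mu x)%:E.
Proof. by move=> /andP[xN x1]; rewrite /rate lt_eqF// gt_eqF. Qed.

(** Reduces lower bounds on [rate], endpoints included, to nearby interior points; the slack [e]
    absorbs the passage to the limit. *)
Lemma rate_ge_cst x (m : \bar R) : -1 <= x <= 1 ->
  (forall e, 0 < e -> exists2 d, 0 < d &
    forall y, -1 < y < 1 -> `|x - y| < d -> (m <= (rate_interior mu y + e)%:E)%E) ->
  (m <= rate mu x)%E.
Proof.
move=> /andP[xN x1] H; apply/lee_addgt0Pr => e e0.
have [d d0 {}H] := H e e0; rewrite -leeBlDr//.
have {}H y : -1 < y < 1 -> `|x - y| < d -> (m - e%:E <= (rate_interior mu y)%:E)%E.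
  by move=> y1 xy; rewrite leeBlDr// -EFinD H.
rewrite /rate; case: eqP => [xe1|/eqP xne1].
  apply: lime_ge; first exact: rate_interior_cvg1.
  near=> y; have y1 : y < 1 by near: y; exact: nbhs_left_lt.
  apply: H.
    rewrite y1 andbT; near: y; apply: nbhs_left_gt; lra.
  rewrite xe1 ger0_norm ?subr_ge0 ?(ltW y1)// ltrBlDr -ltrBlDl.
  near: y; apply: nbhs_left_gt; lra.
case: eqP => [xe1|/eqP xneN1].
  apply: lime_ge; first exact: rate_interior_cvgN1.
  near=> y; have y1 : -1 < y by near: y; exact: nbhs_right_gt.
  apply: H.
    rewrite y1 /=; near: y; apply: nbhs_right_lt; lra.
  rewrite xe1 distrC ger0_norm ?subr_ge0 ?(ltW y1)// ltrBlDr.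
  near: y; apply: nbhs_right_lt; lra.
apply: H; last by rewrite subrr normr0.
by rewrite !lt_neqAle eq_sym xneN1 xN xne1.
Unshelve. all: by end_near. Qed.

Lemma rate_ge0 x : -1 <= x <= 1 -> (0 <= rate mu x)%E.
Proof.
move=> xI; apply: rate_ge_cst => // e e0; exists 1 => // y yI _.
by rewrite lee_fin addr_ge0 ?(ltW e0)// (rate_interior_ge0 hmu).
Qed.

Lemma rate_fenchel x t : -1 <= x <= 1 -> ((x * t - psi t)%:E <= rate mu x)%E.
Proof.
move=> xI; apply: rate_ge_cst => // e e0.
have t0 : 0 < `|t| + 1 by rewrite ltr_pwDr.
exists (e / (`|t| + 1)); first by rewrite divr_gt0.
move=> y yI xy; rewrite lee_fin.
have := fenchel hmu t yI.
suff : (x - y) * t <= e by lra.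
rewrite (le_trans (ler_norm _))// normrM (le_trans (ler_wpM2r _ (ltW xy)))//.
by rewrite mulrAC ler_pdivrMr// ler_wpM2l ?(ltW e0)// lerDl.
Qed.

Lemma rate_tilt_mean t : rate mu (p t) = (p t * t - psi t)%:E.
Proof.
by rewrite rate_interiorE ?rate_interior_tilt_mean// -ltr_norml tilt_mean_lt1.
Qed.

(* Equality in Fenchel's inequality puts the tangent of [psi] at [t] above the
   line of slope [x], whence [0 <= (p (t + h) - x) * h] for all [h]. *)
Lemma rate_fenchel_eq x t r : -1 <= x <= 1 -> rate mu x = r%:E ->
  psi t <= t * x - r -> x = p t.
Proof.
move=> xI xr tr; pose h := (x - p t) / 2.
have := rate_fenchel (t + h) xI; rewrite xr lee_fin => f1.
have f2 := psi_tangent hmu (t + h) t.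
have {f1 f2} : 0 <= (p (t + h) - x) * h by move: f1 f2; lra.
have : `|(p (t + h) - p t) * h| <= h ^+ 2.
  rewrite normrM -real_normK ?num_real// expr2 ler_wpM2r//.
  by rewrite (le_trans (tilt_mean_lipschitz hmu _ _))// addrAC subrr add0r.
rewrite ler_norml => /andP[_ h1] h2.
(* Since [x - p t = 2 * h] and [p] is 1-Lipschitz, [(p (t + h) - x) * h] is at most
   [h ^+ 2 - 2 * h ^+ 2], while it is nonnegative. *)
have : h ^+ 2 <= 0.
  have : x - p t = 2 * h by rewrite /h; field.
  nra.
rewrite le_eqVlt ltNge sqr_ge0 orbF sqrf_eq0 /h mulf_eq0 invr_eq0 pnatr_eq0 orbF.
by rewrite subr_eq0 => /eqP.
Qed.

End rate_theory.
(** * The Mean-Field equations *)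

Section energy_update.
Context (R : realType) (n : nat).
Implicit Types (A : 'M[R]_n) (c x : 'cV[R]_n).

(** The zero diagonal makes the energy affine in each coordinate, and symmetry makes its slope the
    local field. *)
Lemma energy_update A c x (i : 'I_n) (t : R) : coupling_matrix A ->
  energy A c (x + t *: delta_mx i 0) =
  energy A c x + t * ((A *m x) i 0 + c i 0).
Proof.
move=> [At A0]; set e := delta_mx i 0.
have eT m (B : 'M[R]_(n, m)) j : (e^T *m B) 0 j = B i j.
  by rewrite trmx_delta -rowE mxE.
have quad : ((x + t *: e)^T *m A *m (x + t *: e)) 0 0 =
    (x^T *m A *m x) 0 0 + 2 * t * (A *m x) i 0.
  have -> : (x + t *: e)^T = x^T + t *: e^T by rewrite linearD linearZ.
  rewrite !mulmxDl !mulmxDr -!scalemxAl -!scalemxAr.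
  have -> : x^T *m A *m e = (e^T *m (A *m x))^T by rewrite !trmx_mul trmxK At.
  rewrite -!mulmxA.
  have eAe : (A *m e) i 0 = 0 by rewrite -colE mxE A0.
  have addE (B C : 'M[R]_1) : (B + C) 0 0 = B 0 0 + C 0 0 by rewrite mxE.
  have scaleE a (B : 'M[R]_1) : (a *: B) 0 0 = a * B 0 0 by rewrite mxE.
  have trE (B : 'M[R]_1) : B^T 0 0 = B 0 0 by rewrite mxE.
  rewrite !(addE, scaleE, trE) !eT eAe !mulr0 addr0 -addrA -mulrA mulr_natl mulr2n.
  by [].
have lin : (c^T *m (x + t *: e)) 0 0 = (c^T *m x) 0 0 + t * c i 0.
  by rewrite mulmxDr -scalemxAr [LHS]mxE; congr (_ + _); rewrite mxE -colE !mxE.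
by rewrite /energy quad lin; field.
Qed.

End energy_update.

Section stationarity.
Context (R : realType) (n : nat).
Variables (A : 'M[R]_n) (c : 'cV[R]_n) (mu : 'I_n -> probability R R).
Hypotheses (hA : coupling_matrix A) (hmu : forall i, base_measure (mu i)).

(** Comparing [u] with the point whose coordinate [i] is replaced by the tilted mean at its field
    turns optimality into the equality case of Fenchel's inequality. Nothing is differentiated, so
    coordinates on the boundary are covered too. *)
Lemma mf_optimizer_stationary (u : 'cV[R]_n) (i : 'I_n) : mf_optimizer A c mu u ->
  u i 0 = tilt_mean (mu i) ((A *m u) i 0 + c i 0).
Proof.
move=> [uc umax].
have r0 j : (0 <= rate (mu j) (u j ord0))%E by apply: rate_ge0 => //; exact: uc.
(* An infinite rate would make the objective -oo at [u], whereas it is finite at 0. *)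
have fin j : rate (mu j) (u j ord0) \is a fin_num.
  rewrite ge0_fin_numE// ltey; apply/negP => /eqP rj.
  have c0 : in_cube (0 : 'cV[R]_n) by move=> k; rewrite mxE lerN10 ler01.
  have : mf_objective A c mu u = -oo%E.
    rewrite /mf_objective (bigD1 j)//= [X in (_ - (X + _))%E]rj addye ?addeNy//.
    by rewrite gt_eqF// (@lt_le_trans _ _ 0%E) ?ltNyr// sume_ge0.
  have := umax _ c0 => /[swap] ->; rewrite leeNy_eq /mf_objective.
  under eq_bigr do rewrite mxE rate_interiorE ?ltrN10 ?ltr01//.
  by rewrite sumEFin.
pose r j := fine (rate (mu j) (u j ord0)).
have rE j : rate (mu j) (u j ord0) = (r j)%:E by rewrite fineK.
set th := _ + _; pose p := tilt_mean (mu i) th.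
have pI : -1 < p < 1 by rewrite -ltr_norml tilt_mean_lt1.
pose z := u + (p - u i ord0) *: delta_mx i 0.
have zj j : z j ord0 = if j == i then p else u j ord0.
  rewrite !mxE; case: eqP => [->|_]; first by rewrite mulr1 addrC subrK.
  by rewrite mulr0 addr0.
have zc : in_cube z.
  move=> j; rewrite zj; case: ifP => _; last exact: uc.
  by have /andP[/ltW -> /ltW ->] := pI.
have Fz : (\sum_j rate (mu j) (z j ord0) =
    ((p * th - psi (mu i) th) + \sum_(j | j != i) r j)%:E)%E.
  rewrite (bigD1 i)//= zj eqxx rate_tilt_mean// [RHS]EFinD -sumEFin.
  by congr (_ + _)%E; apply: eq_bigr => j /negbTE ji; rewrite zj ji rE.
have Fu : (\sum_j rate (mu j) (u j ord0) = (r i + \sum_(j | j != i) r j)%:E)%E.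
  rewrite (bigD1 i)//= rE [RHS]EFinD -sumEFin.
  by congr (_ + _)%E; apply: eq_bigr => j _; rewrite rE.
have := umax _ zc; rewrite /mf_objective energy_update// Fz Fu.
rewrite -!EFinB lee_fin -/th => h.
by apply: (rate_fenchel_eq (hmu i) (uc i) (rE i)); move: h; lra.
Qed.

End stationarity.

(** * Contraction estimates and linearization *)

Section sums.
Context (R : realType) (n : nat).
Implicit Types (a b : 'I_n -> R).

(** From Lagrange's identity: twice the defect is the sum of the squares of all
    [a i * b j - a j * b i]. *)
Lemma CauchySchwarz_sum a b :
  (\sum_i a i * b i) ^+ 2 <= (\sum_i a i ^+ 2) * (\sum_i b i ^+ 2).
Proof.
have : 0 <= \sum_i \sum_j (a i * b j - a j * b i) ^+ 2.
  by apply: sumr_ge0 => i _; apply: sumr_ge0 => j _; exact: sqr_ge0.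
have -> : \sum_i \sum_j (a i * b j - a j * b i) ^+ 2 =
  \sum_i \sum_j (a i ^+ 2 * b j ^+ 2) + \sum_i \sum_j (a j ^+ 2 * b i ^+ 2)
  - 2 * \sum_i \sum_j ((a i * b i) * (a j * b j)).
  rewrite mulr_sumr -sumrN -!big_split/=; apply: eq_bigr => i _.
  rewrite mulr_sumr -sumrN -!big_split/=; apply: eq_bigr => j _; ring.
rewrite [X in _ + X - _]exchange_big/=.
have dl (f g : 'I_n -> R) : \sum_i \sum_j f i * g j = (\sum_i f i) * \sum_j g j.
  by rewrite mulr_suml; apply: eq_bigr => i _; rewrite mulr_sumr.
by rewrite !dl -expr2; lra.
Qed.

Lemma sum_sqr_le a : (\sum_i a i) ^+ 2 <= n%:R * \sum_i a i ^+ 2.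
Proof.
have := CauchySchwarz_sum (fun=> 1) a.
rewrite (eq_bigr a) => [|i _]; last by rewrite mul1r.
by rewrite expr1n sumr_const card_ord.
Qed.

End sums.

Section contraction.
Context (R : realType) (n : nat).
Implicit Types (A : 'M[R]_n) (x : 'cV[R]_n).

(** For even [k] the [k]-th power of the l_k norm, which keeps roots out of the estimates. *)
Definition spow (k : nat) x := \sum_i x i 0 ^+ k.

Lemma spow2_ge0 x : 0 <= spow 2 x.
Proof. by apply: sumr_ge0 => i _; exact: sqr_ge0. Qed.

Lemma spow4_ge0 x : 0 <= spow 4 x.
Proof. by apply: sumr_ge0 => i _; rewrite exprn_even_ge0. Qed.

Lemma spowZ k a x : spow k (a *: x) = a ^+ k * spow k x.
Proof. by rewrite /spow mulr_sumr; apply: eq_bigr => i _; rewrite mxE exprMn. Qed.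

Lemma le_spow k x i : ~~ odd k -> x i 0 ^+ k <= spow k x.
Proof.
move=> ek; rewrite /spow (bigD1 i)//= lerDl sumr_ge0// => j _.
by rewrite exprn_even_ge0.
Qed.

Lemma lnorm4E x : lnorm 4%:E x = spow 4 x `^ 4^-1.
Proof.
rewrite /lnorm /spow; congr (_ `^ _); apply: eq_bigr => i _.
by rewrite powR_mulrn// -normrX ger0_norm// exprn_even_ge0.
Qed.

Lemma powR4VK (a : R) : 0 <= a -> (a `^ 4^-1) ^+ 4 = a.
Proof.
by move=> a0; rewrite -powR_mulrn ?powR_ge0// -powRrM mulVf// powRr1.
Qed.

Lemma opnorm4_spow A (rho : R) x : 0 <= rho -> opnorm 4%:E A <= rho ->
  spow 4 (A *m x) <= rho ^+ 4 * spow 4 x.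
Proof.
move=> rho0 Arho.
have unit y : spow 4 y <= 1 -> spow 4 (A *m y) <= rho ^+ 4.
  move=> y1; rewrite -(powR4VK (spow4_ge0 _)).
  rewrite lerXn2r ?nnegrE ?powR_ge0// -lnorm4E (le_trans _ Arho)//.
  apply: ub_le_sup; last first.
    exists y => //; rewrite /mkset lnorm4E.
    rewrite [leRHS](_ : 1 = 1 `^ 4^-1); last by rewrite powR1.
    by rewrite ge0_ler_powR ?nnegrE// ?spow4_ge0.
  (* The supremum in [opnorm] dominates its set only if the set is bounded; vectors of the unit ball
     have coordinates at most 1, so absolute row sums give a bound. *)
  exists ((\sum_i (\sum_j `|A i j|) ^+ 4) `^ 4^-1) => _ [w w1 <-].
  have {}w1 : spow 4 w <= 1.
    by rewrite -(powR4VK (spow4_ge0 _)) exprn_ile1 ?powR_ge0// -lnorm4E.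
  have wj j : `|w j 0| <= 1.
    rewrite -(@expr_le1 _ 4)//.
    by rewrite -normrX ger0_norm ?exprn_even_ge0// (le_trans _ w1)// le_spow.
  rewrite lnorm4E ge0_ler_powR ?nnegrE ?spow4_ge0 ?sumr_ge0//.
    by move=> i _; rewrite exprn_even_ge0.
  apply: ler_sum => i _.
  rewrite -[leLHS]ger0_norm ?exprn_even_ge0// normrX lerXn2r ?nnegrE ?sumr_ge0//.
  rewrite mxE (le_trans (ler_norm_sum _ _ _))// ler_sum// => j _.
  by rewrite normrM ler_piMr.
have := spow4_ge0 x; rewrite le_eqVlt => /predU1P[x0|x0].
  have -> : x = 0.
    apply/colP => i; rewrite mxE; apply/eqP.
    have : x i 0 ^+ 4 == 0 by rewrite eq_le exprn_even_ge0// andbT [leRHS]x0 le_spow.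
    by rewrite expf_eq0.
  by rewrite mulmx0 /spow big1 ?mulr0// => i _; rewrite mxE expr0n.
pose s := spow 4 x `^ 4^-1.
have s0 : 0 < s by rewrite powR_gt0.
have s4 : s ^+ 4 = spow 4 x by rewrite powR4VK// ltW.
have := unit (s^-1 *: x); rewrite -scalemxAr !spowZ exprVn s4.
rewrite mulVf ?gt_eqF// => /(_ (lexx _)).
by rewrite ler_pdivrMl// mulrC.
Qed.

End contraction.
Section symmetric_contraction.
Context (R : realType) (n : nat).
Implicit Types (A : 'M[R]_n) (x : 'cV[R]_n).

Lemma bernoulli_unbounded (s C : R) : 1 < s -> exists k, C < s ^+ k.
Proof.
move=> s1; have ds : 0 < s - 1 by rewrite subr_gt0.
pose k := Num.truncn (`|C| / (s - 1)); exists k.+1.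
have bern m : 1 + m%:R * (s - 1) <= s ^+ m.
  elim: m => [|m IH]; first by rewrite mul0r addr0 expr0.
  rewrite exprS (le_trans _ (ler_wpM2l (ltW (lt_trans ltr01 s1)) IH))//.
  rewrite -natr1; have := mulr_ge0 (ler0n R m) (sqr_ge0 (s - 1)); lra.
apply: lt_le_trans (bern _); rewrite (le_lt_trans (ler_norm _))//.
rewrite addrC ltr_pwDr// -ler_pdivrMr// ltW// truncnS_gt//.
Qed.

(* [a k = |A^k x|^2] is log-convex by symmetry, so a first ratio above [rho^2]
   would persist, contradicting the decay [|A^k x|_4 <= rho^k |x|_4]. *)
Lemma spow2_mulmx A (rho : R) x : A^T = A -> 0 < rho ->
  (forall y, spow 4 (A *m y) <= rho ^+ 4 * spow 4 y) ->
  spow 2 (A *m x) <= rho ^+ 2 * spow 2 x.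
Proof.
move=> At rho0 A4; rewrite leNgt; apply/negP => big.
pose y k := iter k (mulmx A) x; pose a k := spow 2 (y k).
have aE k : a k = ((y k)^T *m y k) 0 0.
  by rewrite mxE; apply: eq_bigr => i _; rewrite mxE expr2.
have logc k : a k.+1 ^+ 2 <= a k * a k.+2.
  rewrite {1}aE (_ : _ *m _ = (y k)^T *m y k.+2).
    rewrite mxE; under eq_bigr do rewrite mxE.
    exact: (CauchySchwarz_sum (fun i => y k i 0) (fun i => y k.+2 i 0)).
  by rewrite /y /= trmx_mul At -mulmxA.
have a0 : 0 < a 0%N.
  rewrite lt_neqAle spow2_ge0 andbT eq_sym; apply/eqP => a0.
  have := logc 0%N; rewrite a0 mul0r => a1.
  have : 0 < a 1%N.
    by apply: le_lt_trans big; rewrite mulr_ge0 ?spow2_ge0 ?sqr_ge0.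
  by move=> /(exprn_gt0 2); rewrite ltNge a1.
pose r := a 1%N / a 0%N.
have r0 : rho ^+ 2 < r by rewrite ltr_pdivlMr.
have rp : 0 < r by rewrite (le_lt_trans _ r0)// sqr_ge0.
have grow k : 0 < a k /\ r * a k <= a k.+1.
  elim: k => [|k [ak rak]]; first by rewrite /r divfK// gt_eqF.
  have ak1 : 0 < a k.+1 by rewrite (lt_le_trans _ rak)// mulr_gt0.
  split=> //; rewrite -(ler_pM2l ak) (le_trans _ (logc k))//.
  by rewrite mulrA (mulrC (a k)) expr2 ler_wpM2r// ltW.
have geo k : r ^+ k * a 0%N <= a k.
  elim: k => [|k IH]; first by rewrite expr0 mul1r.
  have [_] := grow k; apply: le_trans.
  by rewrite exprS -mulrA ler_wpM2l// ltW.
have dec k : spow 4 (y k) <= rho ^+ (4 * k) * spow 4 x.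
  elim: k => [|k IH]; first by rewrite muln0 expr0 mul1r.
  rewrite (le_trans (A4 _))// mulnS exprD -mulrA ler_wpM2l//.
  by rewrite exprn_ge0// ltW.
(* Comparing the two norms costs a factor [n%:R] independent of [k], which the geometric growth of
   ratio [r ^+ 2 / rho ^+ 4] overtakes. *)
have up k : a k ^+ 2 <= n%:R * spow 4 (y k).
  rewrite (le_trans (sum_sqr_le _))// ler_wpM2l// ler_sum// => i _.
  by rewrite -exprM.
have s1 : 1 < r ^+ 2 / rho ^+ 4.
  by rewrite ltr_pdivlMr ?exprn_gt0// mul1r (exprM _ 2 2) ltrXn2r ?nnegrE ?sqr_ge0// ltW.
have [k] := bernoulli_unbounded (n%:R * spow 4 x / a 0%N ^+ 2) s1.
rewrite ltNge => /negP; apply.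
have H : (r ^+ k * a 0%N) ^+ 2 <= n%:R * spow 4 x * rho ^+ (4 * k).
  rewrite (@le_trans _ _ (a k ^+ 2))//.
    by rewrite lerXn2r ?nnegrE ?spow2_ge0// mulr_ge0 ?exprn_ge0 ?(ltW a0)// ltW.
  by rewrite (le_trans (up k))// -mulrA ler_wpM2l// mulrC.
rewrite expr_div_n ler_pdivrMr ?exprn_gt0// mulrAC ler_pdivlMr ?exprn_gt0//.
by rewrite -!exprM (mulnC 2) exprM -exprMn.
Qed.

Lemma alpha_ge0 A : 0 <= alpha A.
Proof. by rewrite /alpha; elim/big_ind: _ => // [a b a0 b0|i _]; [rewrite le_max a0|apply: sumr_ge0 => j _; exact: sqr_ge0]. Qed.

Lemma row_le_alpha A i : \sum_j A i j ^+ 2 <= alpha A.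
Proof. exact: (le_bigmax _ (fun i => \sum_j A i j ^+ 2)). Qed.

Lemma alpha_le1 A : A^T = A -> (forall x, spow 2 (A *m x) <= spow 2 x) -> alpha A <= 1.
Proof.
move=> At A2; apply: bigmax_le => // i _.
have := A2 (delta_mx i 0); rewrite -colE /spow.
rewrite (eq_bigr (fun j => A i j ^+ 2)) => [|j _]; last first.
  by rewrite mxE -[in LHS]At mxE.
move/le_trans; apply; rewrite (bigD1 i)//= mxE !eqxx big1 ?addr0 ?expr1n//.
by move=> j /negbTE ji; rewrite mxE ji expr0n.
Qed.

End symmetric_contraction.

(** Convexity of the square with weights [1 - rho] and [rho]. If the squares of the [y] terms sum to
    at most [rho ^+ 2] times a quantity, the last term contributes [rho] times it and can be
    absorbed: this replaces the triangle inequality for norms. *)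
Lemma sqrrD_convex (R : realFieldType) (rho x y : R) : 0 < rho < 1 ->
  (x + y) ^+ 2 <= x ^+ 2 / (1 - rho) + y ^+ 2 / rho.
Proof.
move=> /andP[r0 r1]; have r2 : 0 < 1 - rho by rewrite subr_gt0.
rewrite -subr_ge0.
rewrite (_ : _ - _ = (rho * x - (1 - rho) * y) ^+ 2 / (rho * (1 - rho))).
  by rewrite divr_ge0 ?sqr_ge0// mulr_ge0// ltW.
by field; rewrite !gt_eqF.
Qed.

Lemma expr4D_convex (R : realFieldType) (rho x y : R) : 0 < rho < 1 ->
  (x + y) ^+ 4 <= x ^+ 4 / (1 - rho) ^+ 3 + y ^+ 4 / rho ^+ 3.
Proof.
move=> hr; have /andP[r0 r1] := hr; have r2 : 0 < 1 - rho by rewrite subr_gt0.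
rewrite (exprM _ 2 2) (@le_trans _ _ ((x ^+ 2 / (1 - rho) + y ^+ 2 / rho) ^+ 2))//.
  by rewrite lerXn2r ?nnegrE ?sqr_ge0 ?sqrrD_convex// addr_ge0// divr_ge0 ?sqr_ge0 ?ltW.
rewrite (le_trans (sqrrD_convex _ _ hr))// le_eqVlt; apply/orP; left; apply/eqP.
by field; rewrite !gt_eqF.
Qed.

(** * Linearization at the optimizer *)

Section decomposition.
Context (R : realType) (n : nat).
Variables (A : 'M[R]_n) (c : 'cV[R]_n) (mu : 'I_n -> probability R R) (rho : R).
Hypotheses (hrho : 0 < rho < 1) (hmu : forall i, base_measure (mu i)).
Hypothesis A4 : forall x, spow 4 (A *m x) <= rho ^+ 4 * spow 4 x.
Hypothesis A2 : forall x, spow 2 (A *m x) <= rho ^+ 2 * spow 2 x.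
Implicit Types x q : 'cV[R]_n.

Definition local_field x (i : 'I_n) := (A *m x) i 0 + c i 0.

Definition residual x := \col_i (x i 0 - tilt_mean (mu i) (local_field x i)).

Hypothesis hA : A^T = A.
Variable u : 'cV[R]_n.
Hypothesis hu : forall i, u i 0 = tilt_mean (mu i) (local_field u i).

Let rho0 : 0 < rho. Proof. by have /andP[] := hrho. Qed.

Let rho1 : 0 < 1 - rho. Proof. by rewrite subr_gt0; have /andP[] := hrho. Qed.

Let fieldB x i : local_field x i - local_field u i = (A *m (x - u)) i 0.
Proof. by rewrite /local_field mulmxBr [RHS]mxE [X in _ = _ + X]mxE; ring. Qed.

(** The field error is [A *m residual x] plus [A] applied to differences of tilted means; these are
    at most the field errors, as [tilt_mean] is 1-Lipschitz, so that part is absorbed by the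
    contraction. *)
Lemma local_field_error x :
  spow 4 (A *m (x - u)) <= spow 4 (A *m residual x) / (1 - rho) ^+ 4.
Proof.
set e := A *m (x - u).
pose w := \col_i (tilt_mean (mu i) (local_field x i) - u i 0).
have ew : e = A *m residual x + A *m w.
  by rewrite -mulmxDr; congr (_ *m _); apply/colP => i; rewrite !mxE; ring.
have we : spow 4 (A *m w) <= rho ^+ 4 * spow 4 e.
  rewrite (le_trans (A4 _))// ler_wpM2l ?exprn_ge0 ?(ltW rho0)// ler_sum// => i _.
  rewrite -[leLHS]ger0_norm ?exprn_even_ge0// -[leRHS]ger0_norm ?exprn_even_ge0//.
  rewrite !normrX lerXn2r ?nnegrE// mxE hu -fieldB.
  exact: tilt_mean_lipschitz.
have : spow 4 e <= spow 4 (A *m residual x) / (1 - rho) ^+ 3 + spow 4 (A *m w) / rho ^+ 3.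
  rewrite {1}ew /spow !mulr_suml -big_split/= ler_sum// => i _.
  by rewrite mxE expr4D_convex.
have : spow 4 (A *m w) / rho ^+ 3 <= rho * spow 4 e.
  by rewrite ler_pdivrMr ?exprn_gt0// mulrAC -exprS.
set a := spow 4 (A *m residual x); move=> h1 h2.
have : spow 4 e * (1 - rho) <= a / (1 - rho) ^+ 3 by lra.
rewrite -ler_pdivlMr// -mulrA -invfM -exprSr//.
Qed.

Let d i := tilt_var (mu i) (local_field u i).

Let d2 i : d i ^+ 2 <= 1.
Proof. by have /andP[d0 d1] := tilt_var_bound (hmu i) (local_field u i); rewrite expr_le1. Qed.

Let Dz (z : 'cV[R]_n) := \col_i (d i * z i 0).

Let ADz z : spow 2 (A *m Dz z) <= rho ^+ 2 * spow 2 z.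
Proof.
rewrite (le_trans (A2 _))// ler_wpM2l ?sqr_ge0// ler_sum// => i _.
by rewrite mxE exprMn ler_piMl ?sqr_ge0.
Qed.

(** A vector killed by [B] would be fixed by [A *m Dz _], which shrinks [spow 2] by the factor
    [rho ^+ 2 < 1]. *)
Let resolvent q : exists q', q' = q + A *m Dz q'.
Proof.
pose B := 1%:M - A *m diag_mx (\row_i d i).
have DzE z : Dz z = diag_mx (\row_i d i) *m z.
  by apply/colP => i; rewrite mul_diag_mx !mxE.
have Bu : B \in unitmx.
  rewrite -unitmx_tr -row_free_unit; apply: inj_row_free => v vB.
  have : B *m v^T = 0 by apply: trmx_inj; rewrite trmx_mul trmxK vB trmx0.
  rewrite mulmxBl mul1mx => /eqP; rewrite subr_eq0 -mulmxA -DzE => /eqP vE.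
  have := ADz v^T; rewrite -vE => h.
  have v0 : spow 2 v^T = 0.
    apply/eqP; rewrite eq_le spow2_ge0 andbT.
    have := spow2_ge0 v^T; have : rho ^+ 2 < 1.
      by rewrite expr_lt1// ?ltW//; have /andP[] := hrho.
    nra.
  apply/rowP => j; rewrite [RHS]mxE; apply/eqP; rewrite -sqrf_eq0.
  rewrite eq_le sqr_ge0 andbT -v0 (le_trans _ (le_spow v^T j _))//.
  by rewrite mxE.
exists (invmx B *m q).
rewrite DzE mulmxA; apply/eqP; rewrite -subr_eq; apply/eqP.
by rewrite -{1}[_ *m q]mul1mx -mulmxBl mulmxA mulmxV// mul1mx.
Qed.

(* [q'] solves [(1 - A D) q' = q] with [D] the diagonal matrix of the slopes of
   the means at [u], so that the linear part of [x - u] cancels. *)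
Lemma Tstar_decomposition q : exists2 q',
  spow 2 q' <= spow 2 q / (1 - rho) ^+ 2 &
  forall x, (\sum_i q i 0 * (x i 0 - u i 0) - \sum_i q' i 0 * residual x i 0) ^+ 2
    <= 36 * spow 2 q / (1 - rho) ^+ 6 * spow 4 (A *m residual x).
Proof.
have [q' q'E] := resolvent q.
have q'2 : spow 2 q' <= spow 2 q / (1 - rho) ^+ 2.
  have h1 : spow 2 q' <= spow 2 q / (1 - rho) + spow 2 (A *m Dz q') / rho.
    rewrite {1}q'E /spow !mulr_suml -big_split/= ler_sum// => i _.
    by rewrite mxE sqrrD_convex.
  have h2 : spow 2 (A *m Dz q') / rho <= rho * spow 2 q'.
    by rewrite ler_pdivrMr// mulrAC -expr2.
  have : spow 2 q' * (1 - rho) <= spow 2 q / (1 - rho) by lra.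
  by rewrite -ler_pdivlMr// -mulrA -invfM -expr2.
exists q' => // x; set e := A *m (x - u).
pose r i := tilt_mean (mu i) (local_field x i) - u i 0 - d i * e i 0.
have r4 i : r i ^+ 2 <= 36 * e i 0 ^+ 4.
  rewrite (_ : 36 * _ = (6 * e i 0 ^+ 2) ^+ 2); last by ring.
  rewrite -[leLHS]real_normK ?num_real// lerXn2r ?nnegrE ?(mulr_ge0 _ (sqr_ge0 _))//.
  by rewrite /r hu /e -fieldB tilt_mean_quadratic.
have qE i : q i 0 = q' i 0 - (A *m Dz q') i 0.
  by rewrite {1}q'E mxE addrK.
have -> : \sum_i q i 0 * (x i 0 - u i 0) - \sum_i q' i 0 * residual x i 0 =
    \sum_i q' i 0 * r i.
  (* Moving [A] to the other factor by symmetry pairs [q'] with [x - u] minus the linear term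
     [d i * e i 0]; subtracting the residual leaves exactly [r i]. *)
  under eq_bigr do rewrite qE mulrBl.
  rewrite big_split/= sumrN [X in _ - X - _](_ : _ = \sum_i q' i 0 * (d i * e i 0)).
    rewrite -addrA -opprD -big_split/= -sumrB; apply: eq_bigr => i _.
    by rewrite /r [residual x i 0]mxE; ring.
  transitivity (((A *m Dz q')^T *m (x - u)) 0 0).
    rewrite mxE; apply: eq_bigr => i _; congr (_ * _); last by rewrite !mxE.
    by rewrite [RHS]mxE.
  rewrite trmx_mul hA -mulmxA mxE; apply: eq_bigr => i _.
  by rewrite [_^T _ _]mxE [Dz _ _ _]mxE -/e; ring.
rewrite (le_trans (CauchySchwarz_sum (fun i => q' i 0) r))//.
have q0 : 0 <= spow 2 q by exact: spow2_ge0.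
have E0 : \sum_i r i ^+ 2 <= 36 * (spow 4 (A *m residual x) / (1 - rho) ^+ 4).
  rewrite (@le_trans _ _ (36 * spow 4 e))//; last first.
    by rewrite ler_wpM2l// local_field_error.
  by rewrite mulr_sumr ler_sum.
(* The exponent 6 is 2 from [q'] plus 4 from [local_field_error]; 36 is the square of the 6 in
   [tilt_mean_quadratic]. *)
rewrite [leRHS](_ : _ = (spow 2 q / (1 - rho) ^+ 2) *
  (36 * (spow 4 (A *m residual x) / (1 - rho) ^+ 4))); last first.
  by field; rewrite gt_eqF.
rewrite ler_pM//; last by apply: sumr_ge0 => i _; exact: sqr_ge0.
exact: spow2_ge0.
Qed.

End decomposition.
(** * Resampling one coordinate *)

Section coordinate_swap.
Context d (T : measurableType d) (R : realType).

Definition set_coord n (s : n.-tuple T) (i : 'I_n) (y : T) : n.-tuple T :=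
  [tuple if j == i then y else tnth s j | j < n].

(** The spare point [z.2] holds the resampled value, so that passing to the other member of the
    exchangeable pair is a map of one space. *)
Definition swap_coord n (i : 'I_n) (z : n.-tuple T * T) : n.-tuple T * T :=
  (set_coord z.1 i z.2, tnth z.1 i).

Lemma tnth_set_coord n (s : n.-tuple T) i y j :
  tnth (set_coord s i y) j = if j == i then y else tnth s j.
Proof. by rewrite tnth_mktuple. Qed.

Lemma measurable_set_coord n (i : 'I_n) :
  measurable_fun setT (fun z : n.-tuple T * T => set_coord z.1 i z.2).
Proof.
apply/measurable_fun_tnthP => j; rewrite /comp.
under eq_fun do rewrite tnth_set_coord.
case: (j == i); first exact: measurable_snd.
by apply: (measurableT_comp (measurable_tnth j)); exact: measurable_fst.
Qed.

Lemma measurable_swap_coord n (i : 'I_n) : measurable_fun setT (swap_coord i).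
Proof.
apply: measurable_fun_pair; first exact: measurable_set_coord.
by apply: (measurableT_comp (measurable_tnth i)); exact: measurable_fst.
Qed.

Local Open Scope ereal_scope.

Lemma ge0_integral_prod_measureS n (mu : 'I_n.+1 -> probability T R)
    (F : n.+1.-tuple T -> \bar R) :
  measurable_fun setT F -> (forall s, 0 <= F s) ->
  \int[prod_measure mu]_s F s =
  \int[mu ord0]_x \int[prod_measure (fun i => mu (lift ord0 i))]_t
     F [tuple of x :: t].
Proof.
move=> mF F0.
rewrite [LHS](@ge0_integral_distribution _ _ _ _ _ _ (@cons_pair _ T n))//.
rewrite [LHS](@fubini_tonelli1 _ _ _ _ _ (mu ord0) (prod_measure (fun i => mu (lift ord0 i))) (F \o @cons_pair _ T n))//.
- by apply: measurableT_comp.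
- by move=> x; exact: F0.
Qed.

Lemma set_coord_cons0 n (x y : T) (t : n.-tuple T) :
  set_coord [tuple of x :: t] ord0 y = [tuple of y :: t].
Proof.
apply: eq_from_tnth => j; rewrite tnth_set_coord.
by case: (unliftP ord0 j) => [k ->|->]; rewrite ?eqxx ?tnthS ?tnth0.
Qed.

Lemma set_coord_consS n (x y : T) (t : n.-tuple T) i :
  set_coord [tuple of x :: t] (lift ord0 i) y = [tuple of x :: set_coord t i y].
Proof.
apply: eq_from_tnth => j; rewrite tnth_set_coord.
case: (unliftP ord0 j) => [k ->|->]; last by rewrite !tnth0.
by rewrite !tnthS tnth_set_coord (inj_eq lift_inj).
Qed.

(** By induction on [n], peeling off the first coordinate. When [i] is [ord0], the swap exchanges
    two independent draws from [mu ord0], which is Tonelli once the tail is integrated out into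
    [L]. *)
Lemma ge0_integral_swap_coord n (mu : 'I_n -> probability T R) (i : 'I_n)
    (G : n.-tuple T * T -> \bar R) :
  measurable_fun setT G -> (forall z, 0 <= G z) ->
  \int[prod_measure mu]_s \int[mu i]_y G (s, y) =
  \int[prod_measure mu]_s \int[mu i]_y G (swap_coord i (s, y)).
Proof.
elim: n => [|n IH] in mu i G *; first by case: i.
move=> mG G0.
have mGs : measurable_fun setT (G \o swap_coord i).
  by apply: measurableT_comp => //; exact: measurable_swap_coord.
have mF (H : n.+1.-tuple T * T -> \bar R) : measurable_fun setT H ->
    (forall z, 0 <= H z) ->
    measurable_fun setT (fun s => \int[mu i]_y H (s, y)).
  by move=> mH H0; apply: (@measurable_fun_fubini_tonelli_F _ _ _ _ _ (mu i) H).
rewrite ge0_integral_prod_measureS; [|exact: mF|by move=> s; exact: integral_ge0].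
rewrite [RHS]ge0_integral_prod_measureS; [|exact: (mF _ mGs (fun=> G0 _))|by move=> s; exact: integral_ge0].
have mcons x : measurable_fun setT (fun z : n.-tuple T * T => ([tuple of x :: z.1], z.2)).
  apply: measurable_fun_pair => //.
  by apply: (@measurable_cons _ _ _ _ (cst x) n fst).
case: (unliftP ord0 i) mGs => [j ->|->] mGs.
  apply: eq_integral => x _.
  have -> := IH (fun i => mu (lift ord0 i)) j (fun z => G ([tuple of x :: z.1], z.2)).
  - apply: eq_integral => t _; apply: eq_integral => y _.
    by rewrite /swap_coord/= set_coord_consS tnthS.
  - exact: (measurableT_comp mG (mcons x)).
  - by [].
under [RHS]eq_integral => x _.
  under eq_integral => t _.
    under eq_integral => y _ do rewrite /swap_coord/= set_coord_cons0 tnth0.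
    over.
  over.
set nu := prod_measure _.
pose L (z : T * T) := \int[nu]_t G ([tuple of z.1 :: t], z.2).
have mL : measurable_fun setT L.
  apply: (@measurable_fun_fubini_tonelli_F _ _ _ _ _ nu
    (fun w : (T * T) * n.-tuple T => G ([tuple of w.1.1 :: w.2], w.1.2))) => //.
  apply: (measurableT_comp mG); apply: measurable_fun_pair; last exact: measurableT_comp.
  apply: (@measurable_cons _ _ _ _ (fst \o fst) n snd) => //.
  exact: measurableT_comp.
have L0 z : 0 <= L z by exact: integral_ge0.
transitivity (\int[mu ord0]_x \int[mu ord0]_y L (x, y)).
  apply: eq_integral => x _.
  apply: (@fubini_tonelli _ _ _ _ _ nu (mu ord0) (fun z => G ([tuple of x :: z.1], z.2))) => //.
  exact: (measurableT_comp mG (mcons x)).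
rewrite (@fubini_tonelli _ _ _ _ _ (mu ord0) (mu ord0) L)//.
apply: eq_integral => x _.
rewrite (@fubini_tonelli _ _ _ _ _ nu (mu ord0) (fun z => G ([tuple of z.2 :: z.1], x)))//.
apply: (measurableT_comp mG); apply: measurable_fun_pair => //.
by apply: (@measurable_cons _ _ _ _ snd n fst).
Qed.

End coordinate_swap.
Lemma ebounded_continuous d (T : measurableType d) (R : realType) (D : set T)
    (h : R -> R) (f : T -> R) :
  continuous h -> ebounded D f -> ebounded D (fun x => h (f x)).
Proof.
move=> ch [mf [M fM]]; split.
  by apply: measurableT_comp => //; exact: continuous_measurable_fun.
have /compact_bounded[N [_ hN]] : compact (h @` `[- M, M]%classic).
  by apply: continuous_compact; [exact: continuous_subspaceT|exact: segment_compact].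
exists (N + 1) => x Dx; apply: hN; first by rewrite ltrDl.
by exists (f x) => //=; rewrite in_itv/= -ler_norml fM.
Qed.

(** * Integration over the space with a spare point *)

Section joint_integral.
Context (R : realType) (n : nat) (mu : 'I_n -> probability R R).
Hypothesis hmu : forall i, base_measure (mu i).

Definition cube : set (n.-tuple R) := [set s | forall i, `[-1, 1]%classic (tnth s i)].

Lemma measurable_cube : measurable cube.
Proof.
by apply: (@measurable_box _ R n (fun=> `[-1, 1]%classic)) => i; exact: measurable_itv.
Qed.

Lemma prod_measure_cube : prod_measure mu cube = 1%E.
Proof.
rewrite (@prod_measureE _ _ _ _ mu (fun=> `[-1, 1]%classic))//.
by rewrite big1// => i _; have [] := hmu i.
Qed.

Variable i : 'I_n.

Definition joint : probability (n.-tuple R * R)%type R :=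
  prob_prod (prod_measure mu) (mu i).

Definition cube2 : set (n.-tuple R * R) := cube `*` `[-1, 1]%classic.

Lemma measurable_cube2 : measurable cube2.
Proof. by apply: measurableX; [exact: measurable_cube|exact: measurable_itv]. Qed.

Lemma joint_cube2 : joint cube2 = 1%E.
Proof.
rewrite [LHS]product_measure1E//; last exact: measurable_cube.
have [m1 _ _ _] := hmu i.
by rewrite [X in (X * _)%E]prod_measure_cube [X in (_ * X)%E]m1 mule1.
Qed.

Lemma ebounded_fst (g : n.-tuple R -> R) :
  ebounded cube g -> ebounded cube2 (fun z => g z.1).
Proof.
move=> [mg [M gM]]; split; first exact: measurableT_comp.
by exists M => -[s y] [/= cs _]; exact: gM.
Qed.

Lemma ebounded_snd : ebounded cube2 (fun z => z.2).
Proof.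
split; first exact: measurable_snd.
by exists 1 => -[s y] [_ /=]; rewrite in_itv/= -ler_norml.
Qed.

Lemma cube2_swap z : cube2 z -> cube2 (swap_coord i z).
Proof.
move=> [cs cy]; split => [j|]; last exact: cs.
by rewrite /= tnth_set_coord; case: ifP => _ //; exact: cs.
Qed.

Lemma ebounded_swap (g : n.-tuple R * R -> R) :
  ebounded cube2 g -> ebounded cube2 (fun z => g (swap_coord i z)).
Proof.
move=> [mg [M gM]]; split.
  by apply: measurableT_comp => //; exact: measurable_swap_coord.
by exists M => z /cube2_swap; exact: gM.
Qed.

Lemma joint_swap (g : n.-tuple R * R -> R) : measurable_fun setT g ->
  \int[joint]_z g (swap_coord i z) = \int[joint]_z g z.
Proof.
move=> mg; rewrite /Rintegral; congr fine.
have pos (G : n.-tuple R * R -> \bar R) : measurable_fun setT G ->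
    (forall z, (0 <= G z)%E) ->
    (\int[joint]_z (G \o swap_coord i) z = \int[joint]_z G z)%E.
  move=> mG G0.
  have mGs : measurable_fun setT (G \o swap_coord i).
    by apply: measurableT_comp => //; exact: measurable_swap_coord.
  rewrite [LHS](@fubini_tonelli1 _ _ _ _ _ (prod_measure mu) (mu i))//; last first.
    by move=> z; exact: G0.
  rewrite [RHS](@fubini_tonelli1 _ _ _ _ _ (prod_measure mu) (mu i))//.
  by rewrite [RHS](ge0_integral_swap_coord mu i mG G0).
have mE : measurable_fun setT (EFin \o g) by exact/measurable_EFinP.
rewrite integralE [RHS]integralE; congr (_ - _)%E.
  rewrite -[RHS]pos//; last exact: measurable_funepos.
  by apply: eq_integral => z _; rewrite /= !funeposE.
rewrite -[RHS]pos//; last exact: measurable_funeneg.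
by apply: eq_integral => z _; rewrite /= !funenegE.
Qed.

(** Sections are required to be bounded for every [s], even off the cube, so that each inner
    extended integral is finite and agrees with its real value. *)
Lemma joint_fubini (g : n.-tuple R * R -> R) : ebounded cube2 g ->
  (forall s, ebounded (`[-1, 1]%classic : set R) (fun y => g (s, y))) ->
  \int[joint]_z g z = \int[prod_measure mu]_s \int[mu i]_y g (s, y).
Proof.
move=> eg egs; rewrite /Rintegral; congr fine.
have ig := ebounded_integrable measurable_cube2 joint_cube2 eg.
rewrite -[LHS](@integral12_prod_meas1 _ _ _ _ _ (prod_measure mu) (mu i) (EFin \o g))//.
apply: eq_integral => s _; rewrite /= fineK//.
apply: integrable_fin_num => //.
have [m1 _ _ _] := hmu i.
exact: (ebounded_integrable (measurable_itv _) m1 (egs s)).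
Qed.

End joint_integral.

(** * The conditional kernel and the exchangeable pair *)

Section gibbs_exchange.
Context (R : realType) (n : nat).
Variables (A : 'M[R]_n) (c : 'cV[R]_n) (mu : 'I_n -> probability R R).
Hypotheses (hA : coupling_matrix A) (hmu : forall i, base_measure (mu i)).
Implicit Types (s : n.-tuple R) (z : n.-tuple R * R) (i : 'I_n).

Local Notation nu := (prod_measure mu).
Local Notation D := (@cube R n).
Local Notation D2 := (@cube2 R n).

Definition weight s : R := expR (energy A c (colv s)).

Definition tfield i s : R := local_field A c (colv s) i.

(* The density at [z.2] of the law of coordinate [i] given the others. *)
Definition gibbs_kernel i z : R :=
  expR (z.2 * tfield i z.1) / mexp (mu i) 0 (tfield i z.1).

Lemma ebounded_tnth i : ebounded D (fun s => tnth s i).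
Proof.
split; first exact: measurable_tnth.
by exists 1 => s /(_ i); rewrite /= in_itv/= -ler_norml.
Qed.

Lemma tfieldE i s : tfield i s = \sum_j A i j * tnth s j + c i 0.
Proof.
by rewrite /tfield /local_field mxE; congr (_ + _); apply: eq_bigr => j _; rewrite mxE.
Qed.

Lemma ebounded_tfield i : ebounded D (tfield i).
Proof.
rewrite (_ : tfield i = fun s => \sum_j A i j * tnth s j + c i 0); last first.
  by apply/funext => s; exact: tfieldE.
apply: eboundedD; last exact: ebounded_cst.
apply: ebounded_sum => j; apply: eboundedM; first exact: ebounded_cst.
exact: ebounded_tnth.
Qed.

Lemma ebounded_weight : ebounded D weight.
Proof.
apply: ebounded_expR.
rewrite (_ : (fun s => energy A c (colv s)) = fun s =>
    2^-1 * (\sum_i (\sum_j tnth s j * A j i) * tnth s i) + \sum_i c i 0 * tnth s i).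
  have ec r : ebounded D (fun=> r : R) by exact: ebounded_cst.
  apply: eboundedD.
    apply: eboundedM => //; apply: ebounded_sum => i.
    apply: eboundedM; last exact: ebounded_tnth.
    by apply: ebounded_sum => j; apply: eboundedM => //; exact: ebounded_tnth.
  by apply: ebounded_sum => i; apply: eboundedM => //; exact: ebounded_tnth.
apply/funext => s; rewrite energyE; congr (_ * _ + _).
  apply: eq_bigr => i _; rewrite mxE; congr (_ * _).
  by apply: eq_bigr => j _; rewrite mxE.
by apply: eq_bigr => i _; rewrite mxE.
Qed.

Lemma continuous_inv_mexp0 i : continuous (fun t => (mexp (mu i) 0 t)^-1).
Proof.
move=> t; apply: cvgV; first by rewrite gt_eqF// mexp0_gt0.
exact: continuous_mexp.
Qed.

Lemma ebounded_gibbs_kernel i : ebounded D2 (gibbs_kernel i).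
Proof.
apply: eboundedM.
  apply: ebounded_expR; apply: eboundedM; first exact: ebounded_snd.
  by apply: ebounded_fst; exact: ebounded_tfield.
apply: (@ebounded_fst _ _ (fun s => (mexp (mu i) 0 (tfield i s))^-1)).
exact: ebounded_continuous (@continuous_inv_mexp0 i) (ebounded_tfield i).
Qed.

Lemma gibbs_kernel_ge0 i z : 0 <= gibbs_kernel i z.
Proof. by rewrite divr_ge0 ?expR_ge0// ltW// mexp0_gt0. Qed.

Lemma colv_set_coord s i y :
  colv (set_coord s i y) = colv s + (y - tnth s i) *: delta_mx i 0.
Proof.
apply/colP => j; rewrite !mxE tnth_set_coord eqxx andbT.
case: eqP => [->|_]; first by rewrite mulr1 addrC subrK.
by rewrite mulr0 addr0.
Qed.

Lemma tfield_set_coord s i j y :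
  tfield j (set_coord s i y) = tfield j s + A j i * (y - tnth s i).
Proof.
rewrite /tfield /local_field colv_set_coord mulmxDr -scalemxAr mxE.
by rewrite [X in _ + X + _]mxE -colE [col _ _ _ _]mxE; ring.
Qed.

(** Detailed balance: the swap leaves the field at [i] unchanged, because the diagonal vanishes, and
    the change in [weight] cancels the change in the exponential of the kernel. *)
Lemma weight_kernel_swap i z :
  weight (swap_coord i z).1 * gibbs_kernel i (swap_coord i z) =
  weight z.1 * gibbs_kernel i z.
Proof.
rewrite /weight /gibbs_kernel /= tfield_set_coord hA.2 mul0r addr0.
rewrite colv_set_coord energy_update// !mulrA -!expRD; congr (expR _ * _).
by rewrite /tfield /local_field; ring.
Qed.

Lemma set_coordK s i y : set_coord (set_coord s i y) i (tnth s i) = s.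
Proof.
apply: eq_from_tnth => j; rewrite !tnth_set_coord.
by case: eqP => [->|].
Qed.

Lemma Rintegral_gibbs_kernel i s : \int[mu i]_y gibbs_kernel i (s, y) = 1.
Proof.
rewrite /gibbs_kernel /=; under eq_Rintegral do rewrite mulrC (mulrC _ (tfield i s)).
have [m1 _ _ _] := hmu i.
rewrite (_ : \int[mu i]_y _ = (mexp (mu i) 0 (tfield i s))^-1 * mexp (mu i) 0 (tfield i s)).
  by rewrite mulVf// gt_eqF// mexp0_gt0.
rewrite -(ebounded_RintegralZ (measurable_itv _) m1 _ (ebounded_pow_exp 0 _)).
by apply: eq_Rintegral => y _; rewrite expr0 mul1r.
Qed.

Let ebk i s : ebounded (`[-1, 1]%classic : set R) (fun y => gibbs_kernel i (s, y)).
Proof.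
rewrite /gibbs_kernel /=; apply: eboundedM; last exact: ebounded_cst.
rewrite (_ : (fun _ => _) = (fun y => y ^+ 0 * expR (tfield i s * y))).
  exact: ebounded_pow_exp.
by apply/funext => y; rewrite expr0 mul1r mulrC.
Qed.

Let ebyk i s : ebounded (`[-1, 1]%classic : set R) (fun y => y * gibbs_kernel i (s, y)).
Proof.
apply: eboundedM => //; split; first exact: measurable_id.
by exists 1 => y; rewrite /= in_itv/= -ler_norml.
Qed.

Lemma Rintegral_id_gibbs_kernel i s :
  \int[mu i]_y (y * gibbs_kernel i (s, y)) = tilt_mean (mu i) (tfield i s).
Proof.
have [m1 _ _ _] := hmu i.
rewrite /tilt_mean mulrC.
rewrite -(ebounded_RintegralZ (measurable_itv _) m1 _ (ebounded_pow_exp 1 _)).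
by apply: eq_Rintegral => y _; rewrite /gibbs_kernel expr1 /= (mulrC (tfield i s)); ring.
Qed.

Lemma joint_weight i (g : n.-tuple R -> R) : ebounded D g ->
  \int[joint mu i]_z (weight z.1 * gibbs_kernel i z * g z.1) =
  \int[nu]_s (weight s * g s).
Proof.
move=> eg; have [m1 _ _ _] := hmu i.
rewrite joint_fubini//.
- apply: eq_Rintegral => s _ /=; under eq_Rintegral do rewrite mulrAC.
  by rewrite (ebounded_RintegralZ (measurable_itv _) m1)// Rintegral_gibbs_kernel mulr1.
- apply: eboundedM; last exact: ebounded_fst.
  apply: eboundedM; last exact: ebounded_gibbs_kernel.
  by apply: ebounded_fst; exact: ebounded_weight.
- move=> s /=; apply: eboundedM; last exact: ebounded_cst.
  by apply: eboundedM => //; exact: ebounded_cst.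
Qed.

(** Under the kernel the spare point has mean [tilt_mean] at the local field, so integrating it out
    turns the difference into the residual. *)
Lemma joint_residual i (g : n.-tuple R -> R) : ebounded D g ->
  \int[joint mu i]_z (weight z.1 * gibbs_kernel i z * ((tnth z.1 i - z.2) * g z.1)) =
  \int[nu]_s (weight s * (residual A c mu (colv s) i 0 * g s)).
Proof.
move=> eg; have [m1 _ _ _] := hmu i.
have ec (r : R) : ebounded (`[-1, 1]%classic : set R) (fun=> r) by exact: ebounded_cst.
rewrite joint_fubini//.
- apply: eq_Rintegral => s _ /=.
  transitivity (\int[mu i]_y ((weight s * g s) *
     (tnth s i * gibbs_kernel i (s, y) - y * gibbs_kernel i (s, y)))).
    by apply: eq_Rintegral => y _; ring.
  rewrite (ebounded_RintegralZ (measurable_itv _) m1); last first.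
    by apply: eboundedB => //; apply: eboundedM.
  rewrite (ebounded_RintegralB (measurable_itv _) m1)//; last exact: eboundedM.
  rewrite (ebounded_RintegralZ (measurable_itv _) m1)//.
  rewrite Rintegral_gibbs_kernel Rintegral_id_gibbs_kernel mulr1.
  by rewrite [residual _ _ _ _ _ _]mxE [colv s i 0]mxE -/(tfield i s); ring.
- apply: eboundedM.
    apply: eboundedM; last exact: ebounded_gibbs_kernel.
    by apply: ebounded_fst; exact: ebounded_weight.
  apply: eboundedM; last exact: ebounded_fst.
  apply: eboundedB; last exact: ebounded_snd.
  by apply: (ebounded_fst (ebounded_tnth i)).
- move=> s /=; apply: eboundedM; first by apply: eboundedM.
  apply: eboundedM => //; apply: eboundedB => //.
  split; first exact: measurable_id.
  by exists 1 => y; rewrite /= in_itv/= -ler_norml.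
Qed.

(* The exchangeable-pair bound: resampling coordinate [i] preserves the model,
   so [s i - E(s i | rest)] may be tested against a difference of values. *)
Lemma exchange_bound i (f Delta : n.-tuple R -> R) (h k : R -> R) :
  ebounded D f -> ebounded D Delta ->
  ebounded D (h \o f) -> ebounded D (k \o f) ->
  (forall x, 0 <= k x) ->
  (forall x y, `|h x - h y| <= `|x - y| * (k x + k y)) ->
  (forall s y, D s -> -1 <= y <= 1 -> `|f s - f (set_coord s i y)| <= Delta s) ->
  `|\int[nu]_s (weight s * (residual A c mu (colv s) i 0 * h (f s)))| <=
  2 * \int[nu]_s (weight s * (Delta s * k (f s))).
Proof.
move=> ef eD eh ek k0 hk fD.
have mD2 := @measurable_cube2 R n; have PD2 := joint_cube2 hmu i.
pose W z := weight z.1 * gibbs_kernel i z.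
have eW : ebounded D2 W.
  apply: eboundedM; last exact: ebounded_gibbs_kernel.
  by apply: ebounded_fst; exact: ebounded_weight.
have W0 z : 0 <= W z by rewrite mulr_ge0 ?expR_ge0 ?gibbs_kernel_ge0.
have Ws z : W (swap_coord i z) = W z by exact: weight_kernel_swap.
have efst (g : n.-tuple R -> R) : ebounded D g -> ebounded D2 (fun z => g z.1).
  by exact: ebounded_fst.
have esw (g : n.-tuple R -> R) : ebounded D g -> ebounded D2 (fun z => g (set_coord z.1 i z.2)).
  by move=> eg; exact: (ebounded_swap i (ebounded_fst eg)).
have e1 : ebounded D2 (fun z => tnth z.1 i - z.2).
  apply: eboundedB; last exact: ebounded_snd.
  exact: (efst _ (ebounded_tnth i)).
have e2 : ebounded D2 (fun z => `|f z.1 - f (set_coord z.1 i z.2)|).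
  by apply: ebounded_norm; apply: eboundedB; [exact: efst|exact: esw].
pose Phi z := W z * ((tnth z.1 i - z.2) * h (f z.1)).
have ePhi : ebounded D2 Phi.
  by apply: eboundedM => //; apply: eboundedM => //; exact: (efst _ eh).
pose Psi z := W z * (`|f z.1 - f (set_coord z.1 i z.2)| * k (f z.1)).
have ePsi : ebounded D2 Psi.
  by apply: eboundedM => //; apply: eboundedM => //; exact: (efst _ ek).
have ePhis := ebounded_swap i ePhi; have ePsis := ebounded_swap i ePsi.
have swPhi : \int[joint mu i]_z Phi (swap_coord i z) = \int[joint mu i]_z Phi z.
  by apply: joint_swap; case: ePhi.
have swPsi : \int[joint mu i]_z Psi (swap_coord i z) = \int[joint mu i]_z Psi z.
  by apply: joint_swap; case: ePsi.
have PhiE : \int[nu]_s (weight s * (residual A c mu (colv s) i 0 * h (f s))) =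
    \int[joint mu i]_z Phi z by rewrite -joint_residual.
have dbl : 2 * \int[joint mu i]_z Phi z =
    \int[joint mu i]_z (Phi z + Phi (swap_coord i z)).
  by rewrite (ebounded_RintegralD mD2 PD2)// swPhi; ring.
have PsiD : \int[joint mu i]_z Psi z <= \int[nu]_s (weight s * (Delta s * k (f s))).
  rewrite -(joint_weight i (eboundedM eD ek)).
  apply: (le_ebounded_Rintegral mD2 PD2) => //.
    by apply: eboundedM => //; apply: (efst _ (eboundedM eD ek)).
  move=> -[s y] [/= Ds]; rewrite in_itv/= => y1.
  by rewrite /Psi ler_wpM2l// ler_wpM2r//= fD.
(* The swap changes the sign of [tnth z.1 i - z.2], which is at most 2 in absolute value, so
   symmetrizing produces a difference of values of [h]. *)
have bnd z : D2 z -> `|Phi z + Phi (swap_coord i z)| <= 2 * (Psi z + Psi (swap_coord i z)).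
  move=> Dz; rewrite /Phi /Psi Ws /swap_coord/= tnth_set_coord eqxx set_coordK.
  rewrite (distrC (f (set_coord _ _ _))).
  set s' := set_coord _ _ _; set t := tnth _ _ - _.
  rewrite -(opprB _ z.2) -/t -mulrDr -mulrDr mulrCA normrM (ger0_norm (W0 z)).
  rewrite ler_wpM2l// mulNr -mulrBr normrM -mulrDr ler_pM//.
  rewrite /t; case: Dz => /(_ i); rewrite /= !in_itv/= => s1 y1.
  by rewrite ler_norml; apply/andP; split; lra.
rewrite PhiE -(@ler_pM2l _ 2)// -[X in X * `|_|]ger0_norm// -normrM dbl.
apply: (@le_trans _ _ (\int[joint mu i]_z (2 * (Psi z + Psi (swap_coord i z))))).
  have e3 : ebounded D2 (fun z => Phi z + Phi (swap_coord i z)) by exact: eboundedD.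
  have e4 : ebounded D2 (fun z => 2 * (Psi z + Psi (swap_coord i z))).
    by apply: eboundedM; [exact: ebounded_cst|exact: eboundedD].
  rewrite ler_norml -mulN1r -(ebounded_RintegralZ mD2 PD2)//.
  have e5 : ebounded D2 (fun z => -1 * (2 * (Psi z + Psi (swap_coord i z)))).
    by apply: eboundedM => //; exact: ebounded_cst.
  apply/andP; split; apply: (le_ebounded_Rintegral mD2 PD2) => // z /bnd;
    rewrite ler_norml => /andP[]//.
  by rewrite mulN1r.
rewrite (ebounded_RintegralZ mD2 PD2); last exact: eboundedD.
rewrite (ebounded_RintegralD mD2 PD2)// swPsi ler_wpM2l//; lra.
Qed.

End gibbs_exchange.
(** * Concentration of the residuals *)

Section gauss_weight.
Context (R : realType) (eta : R).
Hypothesis eta0 : 0 <= eta.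

Definition gauss (x : R) := expR (eta * x ^+ 2).

(** The factors on the right are derivatives of [x * gauss x]. Such a derivative grows with the
    absolute value of its argument, so the larger endpoint controls the difference. *)
Lemma id_gauss_dist (x y : R) :
  `|x * gauss x - y * gauss y| <= `|x - y| *
    ((1 + 2 * eta * x ^+ 2) * gauss x + (1 + 2 * eta * y ^+ 2) * gauss y).
Proof.
wlog yx : x y / `|y| <= `|x|.
  move=> H; have [/H//|/ltW/H] := leP `|y| `|x|.
  by rewrite distrC (distrC y) (addrC (_ * gauss y)).
have g0 z : 0 <= gauss z by exact: expR_ge0.
have p0 z : 0 <= 1 + 2 * eta * z ^+ 2.
  by rewrite addr_ge0// mulr_ge0 ?sqr_ge0// mulr_ge0.
have sq (z : R) : z ^+ 2 = `|z| ^+ 2 by rewrite real_normK ?num_real.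
have diff : gauss x - gauss y <= eta * (x ^+ 2 - y ^+ 2) * gauss x.
  have := expR_ge1Dx (eta * (y ^+ 2 - x ^+ 2)).
  rewrite -(ler_pM2r (expR_gt0 (eta * x ^+ 2))) -expRD.
  rewrite (_ : eta * (y ^+ 2 - x ^+ 2) + eta * x ^+ 2 = eta * y ^+ 2); last by ring.
  by rewrite -/(gauss x) -/(gauss y); lra.
have yx2 : y ^+ 2 <= x ^+ 2 by rewrite (sq y) (sq x) lerXn2r ?nnegrE.
have diff0 : 0 <= gauss x - gauss y.
  by rewrite subr_ge0 ler_expR ler_wpM2l.
have xy2 : x ^+ 2 - y ^+ 2 <= `|x - y| * (2 * `|x|).
  rewrite (_ : _ - _ = (x - y) * (x + y)); last by ring.
  rewrite (le_trans (ler_norm _))// normrM ler_wpM2l//.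
  by rewrite (le_trans (ler_normD _ _))//; lra.
rewrite (_ : _ - _ = (x - y) * gauss x + y * (gauss x - gauss y)); last by ring.
rewrite (le_trans (ler_normD _ _))// !normrM (ger0_norm (g0 x)) (ger0_norm diff0).
have h1 : `|y| * (gauss x - gauss y) <= `|x| * (eta * (`|x - y| * (2 * `|x|)) * gauss x).
  rewrite ler_pM// (le_trans diff)// ler_wpM2r// ler_wpM2l//.
rewrite (le_trans (lerD (lexx _) h1))// [x ^+ 2]sq.
have : 0 <= `|x - y| * ((1 + 2 * eta * y ^+ 2) * gauss y) by rewrite !mulr_ge0.
lra.
Qed.

End gauss_weight.

(* 224 = 4 * 2 * 28, with 2 from [exchange_bound] and 28 from [sum_influence]. *)
Definition sg_const (R : realType) : R := 224.

Lemma sg_const_gt0 (R : realType) : 0 < sg_const R. Proof. by rewrite /sg_const ltr0n. Qed.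

Section sub_gaussian.
Context (R : realType) (n : nat).
Variables (A : 'M[R]_n) (c : 'cV[R]_n) (mu : 'I_n -> probability R R).
Hypotheses (hA : coupling_matrix A) (hmu : forall i, base_measure (mu i)).
Hypothesis A2 : forall x : 'cV[R]_n, spow 2 (A *m x) <= spow 2 x.
Variable q : 'cV[R]_n.
Implicit Types (s : n.-tuple R) (i : 'I_n).

Local Notation nu := (prod_measure mu).
Local Notation D := (@cube R n).
Local Notation w := (weight A c).

Definition residual_form s := \sum_i q i 0 * residual A c mu (colv s) i 0.

(** Effect on the form of moving coordinate [i] by at most 2: its own term, the first-order response
    of the other conditional means, and the second-order error with 24 = 6 * 2 ^ 2. *)
Let influence s i := 2 * `|q i 0| +
  2 * `|(A *m \col_j (tilt_var (mu j) (tfield A c j s) * q j 0)) i 0| +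
  24 * \sum_j `|q j 0| * A j i ^+ 2.

Let cst (r : R) : ebounded D (fun=> r). Proof. exact: ebounded_cst. Qed.

Lemma ebounded_residual i : ebounded D (fun s => residual A c mu (colv s) i 0).
Proof.
rewrite (_ : (fun _ => _) = fun s => tnth s i - tilt_mean (mu i) (tfield A c i s)).
  apply: eboundedB; first exact: ebounded_tnth.
  exact: ebounded_continuous (continuous_tilt_mean (hmu i)) (ebounded_tfield _ _ _).
by apply/funext => s; rewrite /residual !mxE.
Qed.

Lemma ebounded_residual_form : ebounded D residual_form.
Proof. by apply: ebounded_sum => i; apply: eboundedM => //; exact: ebounded_residual. Qed.

Let ebounded_influence i : ebounded D (influence^~ i).
Proof.
apply: eboundedD => //; apply: eboundedD => //; apply: eboundedM => //.
apply: ebounded_norm.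
rewrite (_ : (fun _ => _) = fun s =>
    \sum_j A i j * (tilt_var (mu j) (tfield A c j s) * q j 0)).
  apply: ebounded_sum => j; apply: eboundedM => //; apply: eboundedM => //.
  exact: ebounded_continuous (continuous_tilt_var (hmu j)) (ebounded_tfield _ _ _).
by apply/funext => s; rewrite mxE; apply: eq_bigr => j _; rewrite mxE.
Qed.

Let residual_form_dist i s (y : R) : D s -> -1 <= y <= 1 ->
  `|residual_form s - residual_form (set_coord s i y)| <= influence s i.
Proof.
move=> Ds y1; have s1 : -1 <= tnth s i <= 1 by have := Ds i; rewrite /= in_itv.
pose dl := y - tnth s i.
have dl2 : `|dl| <= 2 by rewrite ler_norml /dl; apply/andP; split; lra.
pose v j := tilt_var (mu j) (tfield A c j s).
pose b s j := tilt_mean (mu j) (tfield A c j s).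
have resE s' j : residual A c mu (colv s') j 0 = tnth s' j - b s' j.
  by rewrite /residual !mxE.
pose r j := b (set_coord s i y) j - b s j - v j * (A j i * dl).
have r24 j : `|r j| <= 24 * A j i ^+ 2.
  have := tilt_mean_quadratic (hmu j) (tfield A c j (set_coord s i y)) (tfield A c j s).
  have -> : tfield A c j (set_coord s i y) - tfield A c j s = A j i * dl.
    by rewrite tfield_set_coord /dl; ring.
  rewrite -/(b s j) -/(b _ j) -/(v j) -/(r j); move/le_trans; apply; rewrite exprMn.
  have : dl ^+ 2 <= 4.
    rewrite -real_normK ?num_real// (_ : 4 = 2 ^+ 2); last by ring.
    by rewrite lerXn2r ?nnegrE.
  have := sqr_ge0 (A j i); nra.
have -> : residual_form s - residual_form (set_coord s i y) =
    - (q i 0 * dl) + (dl * (A *m \col_j (v j * q j 0)) i 0 + \sum_j q j 0 * r j).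
  rewrite /residual_form -sumrB mxE mulr_sumr -big_split/=.
  have -> : - (q i 0 * dl) = \sum_j (if j == i then - (q i 0 * dl) else 0).
    by rewrite -big_mkcond/= big_pred1_eq.
  rewrite -big_split/=; apply: eq_bigr => j _.
  have Aij : A i j = A j i by rewrite -[in LHS]hA.1 mxE.
  transitivity (q j 0 * (tnth s j - b s j) -
      q j 0 * (tnth (set_coord s i y) j - b (set_coord s i y) j)).
    by congr (_ * _ - _ * _); exact: resE.
  transitivity ((if j == i then - (q i 0 * dl) else 0) +
      (dl * (A j i * (v j * q j 0)) + q j 0 * r j)); last first.
    by congr (_ + (_ * (_ * _) + _)); [rewrite Aij|rewrite mxE].
  rewrite tnth_set_coord /r /dl.
  move: (b s j) (b _ j) (v j) => b1 b2 v1.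
  by case: eqP => [->|_]; ring.
rewrite (le_trans (ler_normD _ _))// /influence -addrA lerD//.
  by rewrite normrN normrM mulrC ler_wpM2r.
rewrite (le_trans (ler_normD _ _))// lerD//.
  by rewrite normrM ler_wpM2r.
rewrite (le_trans (ler_norm_sum _ _ _))// mulr_sumr ler_sum// => j _.
by rewrite normrM mulrCA ler_wpM2l.
Qed.

(** 28 = 2 + 2 + 24, one summand per term of [influence]. The middle one uses the l2 contraction,
    the last that rows of [A] have squared norm at most [alpha A <= 1]. *)
Let sum_influence s : \sum_i `|q i 0| * influence s i <= 28 * spow 2 q.
Proof.
set x := \col_j (tilt_var (mu j) (tfield A c j s) * q j 0).
have x2 : spow 2 (A *m x) <= spow 2 q.
  rewrite (le_trans (A2 _))// ler_sum// => j _; rewrite mxE exprMn ler_piMl ?sqr_ge0//.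
  by have /andP[v0 v1] := tilt_var_bound (hmu j) (tfield A c j s); rewrite expr_le1.
have al : alpha A <= 1 by apply: alpha_le1 A2; exact: hA.1.
have sq (z : R) : z ^+ 2 = `|z| ^+ 2 by rewrite real_normK ?num_real.
have amgm (a b : R) : 2 * (`|a| * `|b|) <= a ^+ 2 + b ^+ 2.
  by rewrite (sq a) (sq b); have := sqr_ge0 (`|a| - `|b|); lra.
pose S := \sum_i \sum_j `|q i 0| * (`|q j 0| * A j i ^+ 2).
have S1 : S <= spow 2 q.
  have rowS i : \sum_j A i j ^+ 2 <= 1 by rewrite (le_trans (row_le_alpha _ _)).
  have T1 : \sum_i \sum_j q i 0 ^+ 2 * A j i ^+ 2 <= spow 2 q.
    rewrite ler_sum// => i _; rewrite -mulr_sumr ler_piMr ?sqr_ge0//.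
    rewrite (eq_bigr (fun j => A i j ^+ 2)) => [|j _]; first exact: rowS.
    by rewrite -[in LHS]hA.1 mxE.
  have T2 : \sum_i \sum_j q j 0 ^+ 2 * A j i ^+ 2 <= spow 2 q.
    rewrite exchange_big/= ler_sum// => i _; rewrite -mulr_sumr ler_piMr ?sqr_ge0//.
  suff : 2 * S <= spow 2 q + spow 2 q by lra.
  rewrite (le_trans _ (lerD T1 T2))// /S mulr_sumr -big_split ler_sum//= => i _.
  rewrite mulr_sumr -big_split ler_sum//= => j _.
  have := ler_wpM2r (sqr_ge0 (A j i)) (amgm (q i 0) (q j 0)).
  by rewrite -mulrDl; move/(le_trans _); apply; rewrite !mulrA.
have -> : \sum_i `|q i 0| * influence s i =
    2 * spow 2 q + \sum_i 2 * (`|q i 0| * `|(A *m x) i 0|) + 24 * S.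
  rewrite /S /spow !mulr_sumr -!big_split/=; apply: eq_bigr => i _.
  rewrite /influence -/x -mulr_sumr sq; ring.
have : \sum_i 2 * (`|q i 0| * `|(A *m x) i 0|) <= spow 2 q + spow 2 (A *m x).
  by rewrite /spow -big_split ler_sum.
lra.
Qed.

Lemma sub_gaussian (Q : R) : 0 < Q -> spow 2 q <= Q ->
  \int[nu]_s (w s * expR (residual_form s ^+ 2 / (sg_const R * Q))) <=
  2 * expR 1 * \int[nu]_s w s.
Proof.
move=> Q0 qQ; have mD := @measurable_cube R n; have nuD := prod_measure_cube hmu.
pose C := 56 * Q; have C0 : 0 < C by rewrite mulr_gt0.
(* Chosen so that [2 * eta * C] is one half: [Y1] then gives [Y <= 2 * C * X], hence
   [eta * Y <= X / 2], which is absorbed in [X1]. *)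
pose eta := (4 * C)^-1; have eta0 : 0 < eta by rewrite invr_gt0 mulr_gt0.
have ew : ebounded D w by exact: ebounded_weight.
have ef := ebounded_residual_form; set f := residual_form in ef *.
have eg : ebounded D (fun s => gauss eta (f s)).
  by apply: ebounded_expR; apply: eboundedM => //; exact: eboundedX.
have ef2g : ebounded D (fun s => f s ^+ 2 * gauss eta (f s)).
  by apply: eboundedM => //; exact: eboundedX.
pose h x := x * gauss eta x.
pose k x := (1 + 2 * eta * x ^+ 2) * gauss eta x.
have g0 x : 0 <= gauss eta x by exact: expR_ge0.
have w0 s : 0 <= w s by exact: expR_ge0.
have k0 x : 0 <= k x.
  by rewrite mulr_ge0// addr_ge0// mulr_ge0 ?sqr_ge0// mulr_ge0// ltW.
have eh : ebounded D (h \o f) by exact: eboundedM.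
have ek : ebounded D (k \o f).
  apply: eboundedM => //; apply: eboundedD => //.
  by apply: eboundedM => //; exact: eboundedX.
pose X := \int[nu]_s (w s * gauss eta (f s)).
pose Y := \int[nu]_s (w s * (f s ^+ 2 * gauss eta (f s))).
have kE : \int[nu]_s (w s * k (f s)) = X + 2 * eta * Y.
  rewrite -(ebounded_RintegralZ mD nuD); last exact: eboundedM.
  rewrite -(ebounded_RintegralD mD nuD); [|exact: eboundedM|].
    by apply: eq_Rintegral => s _; rewrite /k; ring.
  by apply: eboundedM => //; exact: eboundedM.
have Y1 : Y <= C * (X + 2 * eta * Y).
  have er i : ebounded D (fun s => w s * (residual A c mu (colv s) i 0 * h (f s))).
    apply: eboundedM => //; apply: eboundedM => //; exact: ebounded_residual.
  have eDk i : ebounded D (fun s => w s * (influence s i * k (f s))).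
    by apply: eboundedM => //; apply: eboundedM.
  (* One factor [f s] is expanded into residuals; the rest, [h (f s)], is the test function for
     [exchange_bound]. *)
  rewrite -kE; have -> : Y = \sum_i q i 0 *
      \int[nu]_s (w s * (residual A c mu (colv s) i 0 * h (f s))).
    transitivity (\int[nu]_s (\sum_i q i 0 *
        (w s * (residual A c mu (colv s) i 0 * h (f s))))).
      apply: eq_Rintegral => s _.
      transitivity (f s * (w s * h (f s))); first by rewrite /h; ring.
      rewrite {1}/f /residual_form mulr_suml; apply: eq_bigr => i _.
      by move: (h _) (w s) (residual _ _ _ _ _ _) => a b r; ring.
    rewrite (ebounded_Rintegral_sum mD nuD).
      by apply: eq_bigr => i _; rewrite (ebounded_RintegralZ mD nuD).
    by move=> i; exact: eboundedM.
  apply: (@le_trans _ _ (\sum_i `|q i 0| * (2 * \int[nu]_s (w s * (influence s i * k (f s)))))).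
    apply: ler_sum => i _; rewrite (le_trans (ler_norm _))// normrM ler_wpM2l//.
    apply: exchange_bound => //.
    - by move=> x y; apply: id_gauss_dist; exact: ltW.
    - exact: residual_form_dist.
  rewrite (_ : C = 2 * (28 * Q)); last by rewrite /C; ring.
  under eq_bigr do rewrite mulrCA.
  rewrite -mulr_sumr -mulrA ler_wpM2l//.
  under eq_bigr do rewrite -(ebounded_RintegralZ mD nuD)//.
  rewrite -(ebounded_Rintegral_sum mD nuD); last by move=> i; exact: eboundedM.
  rewrite -(ebounded_RintegralZ mD nuD); last exact: eboundedM.
  apply: (le_ebounded_Rintegral mD nuD).
  - by apply: ebounded_sum => i; exact: eboundedM.
  - by apply: eboundedM => //; exact: eboundedM.
  move=> s _.
  rewrite (_ : \sum_i _ = (\sum_i `|q i 0| * influence s i) * (w s * k (f s))).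
    apply: ler_wpM2r; first by rewrite mulr_ge0.
    by apply: le_trans (sum_influence s) _; rewrite ler_wpM2l.
  by rewrite mulr_suml; apply: eq_bigr => i _; ring.
have Y2 : Y <= 2 * C * X.
  have : C * (2 * eta * Y) = Y / 2 by rewrite /eta; field; rewrite gt_eqF.
  lra.
(* Where [eta * f s ^+ 2 <= 1] the exponential is at most [expR 1]; elsewhere it is at most
   [eta * f s ^+ 2] times itself. *)
have X1 : X <= expR 1 * (\int[nu]_s w s) + (4 * C)^-1 * Y.
  rewrite -!(ebounded_RintegralZ mD nuD)//; last exact: eboundedM.
  rewrite -(ebounded_RintegralD mD nuD); [|exact: eboundedM|]; last first.
    by apply: eboundedM => //; exact: eboundedM.
  apply: (le_ebounded_Rintegral mD nuD); first exact: eboundedM.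
    by apply: eboundedD; apply: eboundedM => //; exact: eboundedM.
  move=> s _; rewrite (mulrC (expR 1)) mulrCA -mulrDr ler_wpM2l//.
  rewrite mulrA -/eta; have [le1|gt1] := leP (eta * f s ^+ 2) 1.
    rewrite (@le_trans _ _ (expR 1)) ?ler_expR// lerDl mulr_ge0//.
    by rewrite mulr_ge0 ?sqr_ge0 ?ltW.
  rewrite (@le_trans _ _ (eta * f s ^+ 2 * gauss eta (f s)))//.
    by rewrite ler_peMl// ltW.
  by rewrite lerDr expR_ge0.
have -> : \int[nu]_s (w s * expR (f s ^+ 2 / (sg_const R * Q))) = X.
  apply: eq_Rintegral => s _; congr (_ * expR _).
  by rewrite mulrC /eta /C /sg_const; congr (_^-1 * _); ring.
have : (4 * C)^-1 * Y <= X / 2.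
  by rewrite ler_pdivrMl ?mulr_gt0// (_ : 4 * C * (X / 2) = 2 * C * X)//; field.
lra.
Qed.

End sub_gaussian.
(** * Moments and tails of the statistic *)

Lemma sqr_le_expR (R : realType) (x : R) : 0 <= x -> x ^+ 2 <= 4 * expR x.
Proof.
move=> x0; have e1 := expR_ge1Dx (x / 2).
have -> : expR x = expR (x / 2) ^+ 2 by rewrite expr2 -expRD; congr expR; field.
have : (1 + x / 2) ^+ 2 <= expR (x / 2) ^+ 2.
  by rewrite lerXn2r ?nnegrE ?expR_ge0// addr_ge0// divr_ge0.
lra.
Qed.

(* Jensen's inequality for [exp (sqrt _)], up to a constant since that function
   is only convex away from 0. *)
Lemma expR_sqrt_mean (R : realType) (n : nat) (y : 'I_n -> R) (a : R) :
  (0 < n)%N -> (forall i, 0 <= y i) -> 0 <= a ->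
  n%:R * a ^+ 2 <= \sum_i y i ^+ 2 ->
  expR a <= expR 2 * (n%:R^-1 * \sum_i expR (2 * y i)).
Proof.
move=> n0 y0 a0 ay; have nR : 0 < n%:R :> R by rewrite ltr0n.
set M := n%:R^-1 * _.
have M1 : 1 <= M.
  rewrite /M ler_pdivlMl// mulr1 -[X in X%:R]card_ord -sum1_card natr_sum.
  by rewrite ler_sum// => i _; rewrite -expR0 ler_expR mulr_ge0.
pose T := ln M; have T0 : 0 <= T by exact: ln_ge0.
have TM : expR T = M by rewrite lnK// posrE (lt_le_trans ltr01).
(* Above the threshold [T], the spare factor in [expR (2 * y i)] exceeds [expR T = M]. Averaging
   over [i], the quotients by [M] have mean 1, so [a ^+ 2 <= T ^+ 2 + 4]. *)
have yT i : y i ^+ 2 <= T ^+ 2 + 4 * (expR (2 * y i) / M).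
  have p : 0 <= 4 * (expR (2 * y i) / M) by rewrite mulr_ge0// divr_ge0 ?expR_ge0// -TM expR_ge0.
  have [le|gt] := leP (y i) T.
    rewrite (@le_trans _ _ (T ^+ 2)) ?lerDl// lerXn2r ?nnegrE//.
  rewrite (le_trans (sqr_le_expR (y0 i)))// (@le_trans _ _ (4 * (expR (2 * y i) / M))) ?lerDr ?sqr_ge0//.
  by rewrite ler_wpM2l// -TM -expRN -expRD ler_expR; lra.
have : n%:R * a ^+ 2 <= n%:R * (T ^+ 2 + 4).
  rewrite (le_trans ay)// (le_trans (ler_sum _ (fun i _ => yT i)))//.
  rewrite big_split/= sumr_const card_ord -mulr_sumr -mulr_suml.
  have -> : \sum_i expR (2 * y i) = n%:R * M by rewrite /M mulrA mulfV ?mul1r// gt_eqF.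
  rewrite mulfK ?gt_eqF ?(lt_le_trans ltr01)// -mulr_natl; lra.
rewrite ler_pM2l// => aT.
have : a <= T + 2.
  by rewrite -(@ler_pXn2r _ 2)// ?nnegrE ?addr_ge0//; nra.
by rewrite -TM -expRD ler_expR addrC.
Qed.

(** * Expectations under the model *)

Section model_integral.
Context (R : realType) (n : nat).
Variables (A : 'M[R]_n) (c : 'cV[R]_n) (mu : 'I_n -> probability R R).
Hypothesis hmu : forall i, base_measure (mu i).

Local Notation nu := (prod_measure mu).
Local Notation D := (@cube R n).
Local Notation w := (weight A c).
Local Notation Z := (partition_function A c mu).
Local Notation P := (quadratic_model A c mu).

Let mD := @measurable_cube R n.
Let nuD := prod_measure_cube hmu.

Let Z0 : 0 < Z. Proof. exact: partition_function_gt0. Qed.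

Let ebounded_EFin g : ebounded D g ->
  (\int[nu]_s (g s)%:E = (\int[nu]_s g s)%:E)%E.
Proof.
move=> eg; rewrite /Rintegral fineK//.
by apply: integrable_fin_num => //; exact: ebounded_integrable eg.
Qed.

Let ew : ebounded D (fun s => Z^-1 * w s).
Proof. by apply: eboundedM; [exact: ebounded_cst|exact: ebounded_weight]. Qed.

(** The model is given by its values on sets. Its Radon-Nikodym derivative agrees almost everywhere
    with [Z^-1 * w], both having the same integral over every measurable set by
    [quadratic_modelE]. *)
Lemma quadratic_model_integral (g : n.-tuple R -> R) :
  ebounded D g -> (forall s, 0 <= g s) ->
  (\int[P]_s (g s)%:E = (Z^-1 * \int[nu]_s (w s * g s))%:E)%E.
Proof.
move=> eg g0; have mg : measurable_fun setT (EFin \o g).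
  by apply/measurable_EFinP; case: eg.
have mw : measurable_fun setT (fun s => (Z^-1 * w s)%:E).
  by apply/measurable_EFinP; case: ew.
have dom : P `<< nu.
  apply/null_content_dominatesP => U mU nuU; rewrite quadratic_modelE//.
  by apply: null_set_integral => //; exact: measurable_funTS.
pose dP := Radon_Nikodym_SigmaFinite.f P nu.
have idP : nu.-integrable setT dP by exact: Radon_Nikodym_SigmaFinite.f_integrable.
have ae : ae_eq nu setT dP (fun s => (Z^-1 * w s)%:E).
  apply: integral_ae_eq => //; move=> U _ mU; rewrite -Radon_Nikodym_SigmaFinite.f_integral//.
  exact: quadratic_modelE.
rewrite -(Radon_Nikodym_SigmaFinite.change_of_variables dom)//.
have eZ : ebounded D (fun s => w s * g s) by apply: eboundedM => //; exact: ebounded_weight.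
rewrite -(ebounded_RintegralZ mD nuD)// -ebounded_EFin; last first.
  by apply: eboundedM => //; exact: ebounded_cst.
apply: ae_eq_integral => //.
- by apply: emeasurable_funM => //; exact: measurable_int idP.
- apply/measurable_EFinP; apply: measurable_funM => //.
  by case: eZ.
- apply: filterS ae => s /(_ I) sE _; rewrite /dP in sE.
  by rewrite sE -EFinM; congr EFin; ring.
Qed.

End model_integral.
Section Tstar_bounds.
Context (R : realType) (n : nat) (rho : R).
Variables (A : 'M[R]_n) (c : 'cV[R]_n) (mu : 'I_n -> probability R R).
Variables (q u : 'cV[R]_n).
Hypotheses (hrho : 0 < rho < 1) (hA : coupling_matrix A).
Hypotheses (hmu : forall i, base_measure (mu i)) (hq : spow 2 q = 1).
Hypotheses (hu : mf_optimizer A c mu u) (Arho : opnorm 4%:E A <= rho).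
Implicit Types (s : n.-tuple R) (i : 'I_n).

Local Notation nu := (prod_measure mu).
Local Notation D := (@cube R n).
Local Notation w := (weight A c).
Local Notation Z := (partition_function A c mu).
Local Notation P := (quadratic_model A c mu).
Local Notation F i s := ((A *m residual A c mu (colv s)) i 0).

Let mD := @measurable_cube R n.
Let nuD := prod_measure_cube hmu.
Let C0 : 0 < sg_const R. Proof. exact: sg_const_gt0. Qed.
Let r1 : 0 < 1 - rho. Proof. by have /andP[_] := hrho; rewrite subr_gt0. Qed.
Let rho0 : 0 < rho. Proof. by have /andP[] := hrho. Qed.
Let Z0 : 0 < Z. Proof. exact: partition_function_gt0. Qed.
Let cst (r : R) : ebounded D (fun=> r). Proof. exact: ebounded_cst. Qed.
Let ew : ebounded D w. Proof. exact: ebounded_weight. Qed.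
Let w0 s : 0 <= w s. Proof. exact: expR_ge0. Qed.

Let A4 x : spow 4 (A *m x) <= rho ^+ 4 * spow 4 x.
Proof. by apply: opnorm4_spow => //; exact: ltW. Qed.

Let A2 x : spow 2 (A *m x) <= rho ^+ 2 * spow 2 x.
Proof. by apply: spow2_mulmx => //; exact: hA.1. Qed.

Let A21 (x : 'cV[R]_n) : spow 2 (A *m x) <= spow 2 x.
Proof.
rewrite (le_trans (A2 x))// ler_piMl ?spow2_ge0// expr_le1// ltW//.
by have /andP[] := hrho.
Qed.

Let FE i s : F i s = residual_form A c mu (\col_j A i j) s.
Proof. by rewrite mxE; apply: eq_bigr => j _; rewrite [in RHS]mxE. Qed.

Let eF i : ebounded D (fun s => F i s).
Proof. by under eq_fun do rewrite FE; exact: ebounded_residual_form. Qed.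

Let row2 i : spow 2 (\col_j A i j) <= alpha A.
Proof.
apply: le_trans (row_le_alpha A i); rewrite ler_sum// => j _.
by rewrite mxE.
Qed.

Lemma local_field_sub_gaussian i : 0 < alpha A ->
  \int[nu]_s (w s * expR (F i s ^+ 2 / (sg_const R * alpha A))) <= 2 * expR 1 * Z.
Proof.
move=> al0; have := sub_gaussian c hA hmu A21 al0 (row2 i).
by under eq_Rintegral do rewrite -FE.
Qed.

Lemma Tstar_expansion : exists q' : 'cV[R]_n,
  \int[nu]_s (w s * expR (residual_form A c mu q' s ^+ 2 * ((1 - rho) ^+ 2 / sg_const R))) <=
    2 * expR 1 * Z /\
  forall s, (Tstar q u s - residual_form A c mu q' s) ^+ 2 <=
    36 / (1 - rho) ^+ 6 * \sum_i F i s ^+ 4.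
Proof.
have hu' i := mf_optimizer_stationary hA hmu i hu.
have [q' q'2 q'T] := Tstar_decomposition hrho hmu A4 A2 hA.1 hu' q.
rewrite hq in q'2 q'T; exists q'; split.
  have Q0 : 0 < 1 / (1 - rho) ^+ 2 by rewrite divr_gt0// exprn_gt0.
  have := sub_gaussian c hA hmu A21 Q0 q'2.
  rewrite (_ : (sg_const R * (1 / (1 - rho) ^+ 2)) = ((1 - rho) ^+ 2 / sg_const R)^-1); last first.
    by field; rewrite !gt_eqF.
  by under eq_Rintegral do rewrite invrK.
move=> s; have := q'T (colv s); rewrite mulr1; apply: le_trans.
rewrite le_eqVlt; apply/orP; left; apply/eqP; congr ((_ - _) ^+ 2).
by apply: eq_bigr => i _; rewrite mxE.
Qed.

(** The case [alpha A = 0] is split off because [local_field_sub_gaussian] divides by [alpha A]. *)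
Let F0 i s : alpha A = 0 -> F i s = 0.
Proof.
move=> al0; rewrite mxE big1// => j _; suff -> : A i j = 0 by rewrite mul0r.
apply/eqP; rewrite -sqrf_eq0 eq_le sqr_ge0 andbT -al0.
apply: le_trans (row_le_alpha A i).
by rewrite (bigD1 j)//= lerDl sumr_ge0// => k _; exact: sqr_ge0.
Qed.

Let eT : ebounded D (Tstar q u).
Proof.
apply: ebounded_sum => i; apply: eboundedM => //; apply: eboundedB => //.
exact: ebounded_tnth.
Qed.

(** The first constant is [2 / K] times [2 * expR 1]. In the second, 36 comes from [Tstar_expansion]
    and 16 = 2 * 4 * 2 from splitting the square, from [sqr_le_expR] and from the exponential
    moment. *)
Lemma second_moment_bound :
  ('E_P[(fun s => Tstar q u s ^+ 2)%R] <=
  ((4 * sg_const R * expR 1 / (1 - rho) ^+ 2 + 36 * 16 * sg_const R ^+ 2 * expR 1 / (1 - rho) ^+ 6) *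
   Num.max 1 (n%:R * alpha A ^+ 2))%R%:E)%E.
Proof.
rewrite unlock (quadratic_model_integral A c hmu); last 2 first.
- exact: eboundedX.
- by move=> s; exact: sqr_ge0.
rewrite lee_fin.
have [q' [q'E q'T]] := Tstar_expansion.
set f := residual_form A c mu q' in q'E q'T.
have ef : ebounded D f by exact: ebounded_residual_form.
pose K := (1 - rho) ^+ 2 / sg_const R; rewrite -/K in q'E.
have K0 : 0 < K by rewrite divr_gt0// exprn_gt0.
pose L := 36 / (1 - rho) ^+ 6.
have L0 : 0 <= L by rewrite divr_ge0// exprn_ge0// ltW.
have F4 i : \int[nu]_s (w s * F i s ^+ 4) <= 4 * (sg_const R * alpha A) ^+ 2 * (2 * expR 1 * Z).
  have := alpha_ge0 A; rewrite le_eqVlt => /predU1P[al0|al0].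
    rewrite -al0 mulr0 expr0n mulr0 mul0r (_ : \int[nu]_s _ = \int[nu]_s 0).
      by rewrite Rintegral_cst1.
    by apply: eq_Rintegral => s _; rewrite (F0 i s (esym al0)) expr0n mulr0.
  have al1 : 0 < sg_const R * alpha A by rewrite mulr_gt0.
  rewrite (@le_trans _ _ (\int[nu]_s (4 * (sg_const R * alpha A) ^+ 2 *
     (w s * expR (F i s ^+ 2 / (sg_const R * alpha A))))))//; last first.
    rewrite (ebounded_RintegralZ mD nuD).
      apply: ler_wpM2l; last exact: local_field_sub_gaussian.
      by rewrite pmulr_rge0// sqr_ge0.
    apply: eboundedM => //; apply: ebounded_expR; apply: eboundedM => //.
    exact: eboundedX.
  apply: (le_ebounded_Rintegral mD nuD).
  - by apply: eboundedM => //; exact: eboundedX.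
  - apply: eboundedM => //; apply: eboundedM => //; apply: ebounded_expR.
    by apply: eboundedM => //; exact: eboundedX.
  move=> s _; rewrite [leRHS]mulrCA; apply: ler_wpM2l => //.
  have x0 : 0 <= F i s ^+ 2 / (sg_const R * alpha A) by rewrite divr_ge0 ?sqr_ge0// ltW.
  have := sqr_le_expR x0.
  by rewrite {1}expr_div_n -exprM ler_pdivrMr ?exprn_gt0// [leRHS]mulrAC.
have eg : ebounded D (fun s => w s * expR (f s ^+ 2 * K)).
  by apply: eboundedM => //; apply: ebounded_expR; apply: eboundedM => //; exact: eboundedX.
have eF4 i : ebounded D (fun s => w s * F i s ^+ 4).
  by apply: eboundedM => //; exact: eboundedX.
have main : \int[nu]_s (w s * Tstar q u s ^+ 2) <=
    2 / K * (2 * expR 1 * Z) + 2 * L * (n%:R * (4 * (sg_const R * alpha A) ^+ 2 * (2 * expR 1 * Z))).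
  apply: (@le_trans _ _ (\int[nu]_s (2 / K * (w s * expR (f s ^+ 2 * K)) +
      2 * L * \sum_i (w s * F i s ^+ 4)))).
    apply: (le_ebounded_Rintegral mD nuD).
    - by apply: eboundedM => //; exact: eboundedX.
    - apply: eboundedD; first by apply: eboundedM.
      by apply: eboundedM => //; exact: ebounded_sum.
    move=> s _; rewrite -mulr_sumr !(mulrCA _ (w s)) -mulrDr ler_wpM2l//.
    have h1 := q'T s; rewrite -/L in h1.
    have h2 : f s ^+ 2 <= K^-1 * expR (f s ^+ 2 * K).
      rewrite ler_pdivlMl// mulrC.
      by have := expR_ge1Dx (f s ^+ 2 * K); lra.
    (* This square is the gap in bounding the square of a sum by twice the sum of squares, for [f s]
       and [Tstar q u s - f s]. *)
    have := sqr_ge0 (Tstar q u s - 2 * f s); lra.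
  rewrite (ebounded_RintegralD mD nuD); last 2 first.
  - exact: eboundedM.
  - by apply: eboundedM => //; exact: ebounded_sum.
  rewrite !(ebounded_RintegralZ mD nuD)//; last exact: ebounded_sum.
  apply: lerD; first by apply: ler_wpM2l => //; rewrite divr_ge0// ltW.
  apply: ler_wpM2l; first by rewrite mulr_ge0.
  rewrite (ebounded_Rintegral_sum mD nuD)//.
  rewrite (le_trans (ler_sum _ (fun i _ => F4 i)))//.
  by rewrite sumr_const card_ord -[leLHS]mulr_natl.
rewrite ler_pdivrMl// (le_trans main)//.
have r1' : 1 - rho != 0 by rewrite gt_eqF.
rewrite [leLHS](_ : _ = Z * (4 * sg_const R * expR 1 / (1 - rho) ^+ 2 * 1 +
   36 * 16 * sg_const R ^+ 2 * expR 1 / (1 - rho) ^+ 6 * (n%:R * alpha A ^+ 2))); last first.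
  by rewrite /K /L; field; rewrite !gt_eqF.
have e0 k : 0 <= (1 - rho) ^+ k by rewrite exprn_ge0// ltW.
rewrite ler_wpM2l ?(ltW Z0)// [leRHS]mulrDl; apply: lerD; apply: ler_wpM2l.
- by rewrite divr_ge0// mulr_ge0 ?expR_ge0// mulr_ge0// ltW.
- by rewrite le_max lexx.
- by rewrite divr_ge0// mulr_ge0 ?expR_ge0// mulr_ge0 ?sqr_ge0// mulr_ge0.
- by rewrite le_max lexx orbT.
Qed.

Lemma tail_bound (t : R) : 0 < t ->
  (P [set s | (t <= `|Tstar q u s|)%R] <=
  (2 * expR 3 * expR (- ((1 - rho) ^+ 3 / (24 * sg_const R) * t ^+ 2)) + 2 * expR 3 *
   (if alpha A == 0 then 0
    else expR (- ((1 - rho) ^+ 3 / (24 * sg_const R) * t / (Num.sqrt n%:R * alpha A)))))%:E)%E.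
Proof.
move=> t0; have [q' [q'E q'T]] := Tstar_expansion.
set f := residual_form A c mu q' in q'E q'T.
have ef : ebounded D f by exact: ebounded_residual_form.
pose K := (1 - rho) ^+ 2 / sg_const R; rewrite -/K in q'E.
have K0 : 0 < K by rewrite divr_gt0// exprn_gt0.
(* 24 = 2 * 6 * 2: from the level [t / 2], from the root of 36 in [Tstar_expansion], and from the
   denominator of [y]. It also satisfies [h2 <= K / 4], as the Gaussian term requires. *)
set h2 := (1 - rho) ^+ 3 / (24 * sg_const R).
have n0 : (0 < n)%N.
  rewrite lt0n; apply/eqP => n0; move: hq; rewrite /spow big1.
    by move/eqP; rewrite eq_sym oner_eq0.
  by move=> i; have := ltn_ord i; rewrite [X in (_ < X)%N]n0.
have nR : 0 < n%:R :> R by rewrite ltr0n.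
set U := [set s | _].
have mU : measurable U.
  rewrite (_ : U = (fun s => `|Tstar q u s|) @^-1` `[t, +oo[%classic).
    rewrite -[X in measurable X]setTI.
    have [mT _] := ebounded_norm eT; apply: mT => //; exact: measurable_itv.
  by apply/seteqP; split => s; rewrite /U /= in_itv/= andbT.
pose e1 := expR (- (K / 4 * t ^+ 2)).
pose a0 := h2 * t / (Num.sqrt n%:R * alpha A).
pose e2 := if alpha A == 0 then 0 else expR (- a0).
have e20 : 0 <= e2 by rewrite /e2; case: ifP => // _; exact: expR_ge0.
(* A majorant of the indicator of [U]: the first term exceeds 1 when [f s] is at least [t / 2] in
   absolute value, the second when the quadratic remainder must be that large. *)
pose G s := e1 * expR (f s ^+ 2 * K) +
  e2 * expR 2 * n%:R^-1 * \sum_i expR (F i s ^+ 2 / (sg_const R * alpha A)).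
have eG1 : ebounded D (fun s => expR (f s ^+ 2 * K)).
  by apply: ebounded_expR; apply: eboundedM => //; exact: eboundedX.
have eG2 i : ebounded D (fun s => expR (F i s ^+ 2 / (sg_const R * alpha A))).
  by apply: ebounded_expR; apply: eboundedM => //; exact: eboundedX.
have eG : ebounded D G.
  by apply: eboundedD; apply: eboundedM => //; exact: ebounded_sum.
have G0 s : 0 <= G s.
  rewrite addr_ge0 ?mulr_ge0 ?expR_ge0// ?invr_ge0//.
  by apply: sumr_ge0 => i _; exact: expR_ge0.
have dich s : t <= `|Tstar q u s| -> 1 <= G s.
  move=> tT; have t2 : t ^+ 2 <= Tstar q u s ^+ 2.
    by rewrite -[leRHS]real_normK ?num_real// lerXn2r// nnegrE ltW.
  have [big|small] := leP (t ^+ 2 / 4) (f s ^+ 2).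
    rewrite -[1]addr0 lerD//.
      rewrite -expRD -[leLHS]expR0 ler_expR addrC subr_ge0.
      by have := ler_wpM2l (ltW K0) big; lra.
    rewrite !mulr_ge0 ?expR_ge0 ?invr_ge0//.
    by apply: sumr_ge0 => i _; exact: expR_ge0.
  have S4 : t ^+ 2 / 4 <= (Tstar q u s - f s) ^+ 2.
    move: t2 tT; set x := Tstar q u s => t2 tT.
    have x2 : t / 2 <= `|x - f s|.
      have : `|f s| <= t / 2.
        rewrite -(@ler_pXn2r _ 2)// ?nnegrE ?divr_ge0 ?(ltW t0)//.
        rewrite real_normK ?num_real//; apply: le_trans (ltW small) _.
        by rewrite expr_div_n (_ : 2 ^+ 2 = 4) ?lexx//; ring.
      have := ler_normD (x - f s) (f s); rewrite subrK => h3 h4.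
      by move: h3 h4 tT; lra.
    rewrite -[leRHS]real_normK ?num_real// (_ : t ^+ 2 / 4 = (t / 2) ^+ 2); last by field.
    by rewrite lerXn2r// nnegrE divr_ge0 ?(ltW t0).
  have {S4} S4 := le_trans S4 (q'T s).
  have al0 : 0 < alpha A.
    rewrite lt_neqAle alpha_ge0 andbT; apply/eqP => al0.
    have : 0 < t ^+ 2 / 4 by rewrite divr_gt0// exprn_gt0.
    rewrite ltNge (le_trans S4)// big1 ?mulr0// => i _.
    by rewrite (F0 i s (esym al0)) expr0n.
  (* Scaled so that [2 * y i] is the exponent in [local_field_sub_gaussian]. *)
  pose y i := F i s ^+ 2 / (2 * (sg_const R * alpha A)).
  have Ca : 0 < sg_const R * alpha A by rewrite mulr_gt0.
  have y0 i : 0 <= y i by rewrite divr_ge0 ?sqr_ge0// mulr_ge0// ltW.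
  have sn : 0 < Num.sqrt n%:R :> R by rewrite sqrtr_gt0.
  have h20 : 0 < h2 by rewrite divr_gt0 ?exprn_gt0// mulr_gt0.
  have a00 : 0 <= a0 by apply: divr_ge0; apply: mulr_ge0; exact: ltW.
  have ay : n%:R * a0 ^+ 2 <= \sum_i y i ^+ 2.
    have -> : n%:R * a0 ^+ 2 = (h2 * t / alpha A) ^+ 2.
      rewrite -{1}[n%:R]sqr_sqrtr ?ltW// /a0; field.
      by rewrite !gt_eqF.
    have -> : \sum_i y i ^+ 2 = (\sum_i F i s ^+ 4) / (2 * (sg_const R * alpha A)) ^+ 2.
      by rewrite mulr_suml; apply: eq_bigr => i _; rewrite expr_div_n -exprM.
    rewrite ler_pdivlMr ?exprn_gt0 ?mulr_gt0//.
    rewrite [leLHS](_ : _ = (t ^+ 2 / 4) * ((1 - rho) ^+ 6 / 36)).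
      rewrite -ler_pdivlMr; last by rewrite divr_gt0 ?exprn_gt0.
      by apply: le_trans S4 _; rewrite invf_div mulrC.
    by rewrite /h2; field; rewrite !gt_eqF.
  have := expR_sqrt_mean n0 y0 a00 ay.
  under eq_bigr => i _.
    rewrite (_ : 2 * y i = F i s ^+ 2 / (sg_const R * alpha A)); last first.
      by rewrite /y; field; rewrite gt_eqF.
    over.
  rewrite -[leLHS]mulr1 -ler_pdivlMl ?expR_gt0// -expRN => h.
  apply: le_trans h _; rewrite /G /e2 (gt_eqF al0) !mulrA lerDr.
  by rewrite mulr_ge0 ?expR_ge0.
have eI : ebounded D (\1_U : _ -> R).
  split => //; exists 1 => x _.
  by rewrite indicE; case: (_ \in _); rewrite ?normr0 ?normr1.
have -> : P U = (\int[P]_s (\1_U s)%:E)%E by rewrite integral_indic// setIT.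
rewrite (quadratic_model_integral A c hmu)//.
rewrite lee_fin ler_pdivrMl//.
apply: (@le_trans _ _ (\int[nu]_s (w s * G s))).
  apply: (le_ebounded_Rintegral mD nuD); [exact: eboundedM|exact: eboundedM|].
  move=> s _; rewrite ler_wpM2l// indicE; case: (boolP (s \in U)) => [|_]; last exact: G0.
  by rewrite inE; exact: dich.
have GE : \int[nu]_s (w s * G s) = e1 * \int[nu]_s (w s * expR (f s ^+ 2 * K)) +
    e2 * expR 2 * n%:R^-1 * \sum_i \int[nu]_s (w s * expR (F i s ^+ 2 / (sg_const R * alpha A))).
  have E1 : ebounded D (fun s => w s * expR (f s ^+ 2 * K)) by exact: eboundedM.
  have E2 i : ebounded D (fun s => w s * expR (F i s ^+ 2 / (sg_const R * alpha A))).
    exact: eboundedM.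
  have E3 := ebounded_sum (index_enum 'I_n) E2.
  rewrite -(ebounded_Rintegral_sum mD nuD)// -!(ebounded_RintegralZ mD nuD)//.
  rewrite -(ebounded_RintegralD mD nuD); [|exact: eboundedM|exact: eboundedM].
  by apply: eq_Rintegral => s _; rewrite /G -mulr_sumr; ring.
rewrite GE [leRHS]mulrDr lerD//.
  rewrite (@le_trans _ _ (e1 * (2 * expR 1 * Z)))//.
    by rewrite ler_wpM2l ?expR_ge0.
  rewrite mulrA mulrC ler_wpM2l ?(ltW Z0)// mulrC ler_pM ?expR_ge0 ?mulr_ge0//.
    by rewrite ler_wpM2l// ler_expR ler1n.
  rewrite ler_expR lerN2 ler_wpM2r ?sqr_ge0//.
  rewrite (_ : K / 4 = 6 * (1 - rho) ^+ 2 / (24 * sg_const R)); last first.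
    by rewrite /K; field.
  rewrite ler_wpM2r ?invr_ge0 ?mulr_ge0 ?(ltW C0)// exprS ler_wpM2r ?sqr_ge0//.
  by have := rho0; lra.
rewrite /e2; case: ifPn => [_|al]; first by rewrite !mul0r !mulr0.
have al0 : 0 < alpha A by rewrite lt_neqAle eq_sym al alpha_ge0.
rewrite (@le_trans _ _ (expR (- a0) * expR 2 * n%:R^-1 * (n%:R * (2 * expR 1 * Z))))//.
  rewrite ler_wpM2l ?mulr_ge0 ?expR_ge0 ?invr_ge0//.
  rewrite (le_trans (ler_sum _ (fun i _ => local_field_sub_gaussian i al0)))//.
  by rewrite sumr_const card_ord -[leLHS]mulr_natl.
(* [expR 2] is the loss in [expR_sqrt_mean], [expR 1] the one in [local_field_sub_gaussian]. *)
have -> : expR 3 = expR 2 * expR 1 :> R by rewrite -expRD; congr expR; ring.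
rewrite le_eqVlt; apply/orP; left; apply/eqP.
by rewrite -/a0; field; rewrite gt_eqF.
Qed.

End Tstar_bounds.
Lemma lnorm2_eq1 (R : realType) (n : nat) (q : 'cV[R]_n) :
  lnorm 2%:E q = 1 -> spow 2 q = 1.
Proof.
rewrite /lnorm => q1.
have -> : spow 2 q = \sum_i `|q i 0| `^ 2.
  by apply: eq_bigr => i _; rewrite powR_mulrn// real_normK ?num_real.
have : (\sum_i `|q i 0| `^ 2) `^ (2^-1 * 2) = 1 by rewrite powRrM q1 powR1.
by rewrite mulVf// powRr1// sumr_ge0// => i _; exact: powR_ge0.
Qed.

Theorem theorem2p3 (R : realType) (rho : R) (hrho : 0 < rho < 1) :
  (exists2 C : R, 0 < C &
    forall (n : nat) (A : 'M[R]_n) (c : 'cV[R]_n)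
      (mu : 'I_n -> probability R R) (q u : 'cV[R]_n),
      coupling_matrix A -> (forall i, base_measure (mu i)) ->
      lnorm 2%:E q = 1 -> mf_optimizer A c mu u ->
      opnorm 4%:E A <= rho ->
      ('E_(quadratic_model A c mu)[(fun s => Tstar q u s ^+ 2)%R]
        <= (C * Num.max 1 (n%:R * alpha A ^+ 2))%R%:E)%E)
  /\
  (exists h1 h2 : R, [/\ 0 < h1, 0 < h2 &
    forall (n : nat) (A : 'M[R]_n) (c : 'cV[R]_n)
      (mu : 'I_n -> probability R R) (q u : 'cV[R]_n),
      coupling_matrix A -> (forall i, base_measure (mu i)) ->
      lnorm 2%:E q = 1 -> mf_optimizer A c mu u ->
      opnorm 4%:E A <= rho -> opnorm +oo%E A <= rho ->
      forall t : R, 0 < t ->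
      (quadratic_model A c mu [set s | (t <= `|Tstar q u s|)%R]
        <= (h1 * expR (- (h2 * t ^+ 2))
            + h1 * (if alpha A == 0 then 0
                    else expR (- (h2 * t / (Num.sqrt n%:R * alpha A)))))%:E)%E]).
Proof.
have /andP[rho0 rho1] := hrho; have r1 : 0 < 1 - rho by rewrite subr_gt0.
have C0 := sg_const_gt0 R.
split.
  exists (4 * sg_const R * expR 1 / (1 - rho) ^+ 2 +
    36 * 16 * sg_const R ^+ 2 * expR 1 / (1 - rho) ^+ 6).
    by rewrite addr_gt0// divr_gt0 ?exprn_gt0// mulr_gt0 ?expR_gt0// mulr_gt0// exprn_gt0.
  move=> n A c mu q u hA hmu hq hu hrA.
  exact: second_moment_bound hrho hA hmu (lnorm2_eq1 hq) hu hrA.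
exists (2 * expR 3), ((1 - rho) ^+ 3 / (24 * sg_const R)); split.
- by rewrite mulr_gt0 ?expR_gt0.
- by rewrite divr_gt0 ?exprn_gt0// mulr_gt0.
move=> n A c mu q u hA hmu hq hu hrA _ t t0.
exact: (tail_bound hrho hA hmu (lnorm2_eq1 hq) hu hrA t0).
Qed.
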